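(* Let $\Lambda$ be a category as described in the context, let $(B,\beta)$ be an algebra, $n$ a cardinality admissible for $\Lambda$, and $\delta$ a $G$-action on $\mathbb{C}^n$. Let $(\mathcal{E},U)$ be a functional $(B,\beta)$-module and suppose that $$V:(\mathcal{E},U)\rightarrow B^n=(\mathbb{C}^n\otimes B,\ \delta\otimes\beta)$$ is a functional extension of functional $(B,\beta)$-modules. Then the corner embedding $$e:(B,\beta)\rightarrow \mathcal{K}_B\big((\mathcal{E}\oplus B,\ U\oplus\beta)\big)$$ is invertible in $\Lambda$.
   Context: Fix a discrete group $G$. All algebras are (not necessarily unital, discrete) associative algebras over $\mathbb{C}$ which are quadratik, i.e. every element is a finite sum of products $ab$ of elements of the algebra. Every algebra $A$ carries a $G$-action $\alpha:G\to\mathrm{Aut}(A)$ (a group homomorphism), written $(A,\alpha)$; algebra homomorphisms are $G$-equivariant. Right $A$-modules are also $\mathbb{C}$-vector spaces. A $G$-action on a right $A$-module $M$ is a group homomorphism $S$ from $G$ to the invertible additive maps on $M$ with $S_g(\xi a)=S_g(\xi)\alpha_g(a)$. $\mathrm{Hom}_A(M,N)$ is the abelian group of all (not necessarily equivariant) right $A$-module homomorphisms $(M,S)\to(N,T)$, with $G$-action $g(\phi)=T_g\circ\phi\circ S_{g^{-1}}$; write $\mathrm{ad}(S)$ for this action when $(M,S)=(N,T)$. $\mathrm{Hom}_A(M,A)$ is a left $A$-module via $(a\phi)(\xi)=a\,\phi(\xi)$. A functional $A$-module is a right $A$-module $M$ with $G$-action together with a distinguished $G$-invariant left $A$-submodule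 $\Theta_A(M)\subseteq\mathrm{Hom}_A(M,A)$ (its functional space). The algebra $A$ is a functional module over itself with action $\alpha$ and $\Theta_A(A)=A$ acting by left multiplication. Direct sums $\bigoplus_i\mathcal{E}_i$ (finitely supported) have functional space $\bigoplus_i\Theta_A(\mathcal{E}_i)$ with $(\bigoplus\phi_i)(\bigoplus\xi_i)=\sum_i\phi_i(\xi_i)$ and the direct sum action. For any cardinality $n$, $\mathbb{C}^n$ and $A^n\cong A\otimes\mathbb{C}^n\cong\mathbb{C}^n\otimes A$ denote finitely supported families, with functional space $A^n$ (acting by $x\cdot a=\sum_i x_ia_i$); an action such as $\delta\otimes\alpha$ on $A^n$ has $\delta$ a $G$-action on $\mathbb{C}^n$ and makes $A^n$ a functional module. Compact operators: for functional $A$-modules $M,N$, $\mathcal{K}_A(M,N)\subseteq\mathrm{Hom}_A(M,N)$ is the set of finite sums of the operators $\theta_{\eta,\phi}(\xi)=\eta\,\phi(\xi)$, $\eta\in N$, $\phi\in\Theta_A(M)$. $\mathcal{K}_A(M)=\mathcal{K}_A(M,M)$ is an algebra under composition, with action $\mathrm{ad}(S)$ for $M=(M,S)$. $M_n$ denotes the $n\times n$ matrices over $\mathbb{C}$ with almost all entries zero, $M_n(A)=M_n\otimes A\cong\mathcal{K}_A(A^n)$. Corner embedding: for a functional $(A,\alpha)$-module $(\mathcal{E},S)$, it is the algebra homomorphism $e:(A,\alpha)\to\mathcal{K}_A((\mathcal{E}\oplus A,S\oplus\alpha))$, $e(a)(\xi\oplus b)=0\oplus ab$. Accordingly a corner embedding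 $A\to M_n\otimes A$ is $a\mapsto e_{jj}\otimes a$ for a fixed coordinate $j$ (assumed equivariant). A homomorphism of functional $A$-modules $\mathcal{E}\to\mathcal{F}$ is a pair $(U,U^* )$ with $U:\mathcal{E}\to\mathcal{F}$ a $G$-equivariant right $A$-module homomorphism and $U^*:\Theta_A(\mathcal{E})\to\Theta_A(\mathcal{F})$ a $G$-equivariant left $A$-module homomorphism such that $U^*(\phi)(U(\xi))=\phi(\xi)$ for all $\phi,\xi$. It is a functional extension if $U$ is injective and for all $\phi_1,\dots,\phi_k\in\Theta_A(\mathcal{E})$ and all $\eta\in\mathcal{F}$ there is $\xi\in\mathcal{E}$ with $U^*(\phi_i)(\eta)=\phi_i(\xi)$ for all $1\le i\le k$. The category $\Lambda$: any given category whose objects form a class of algebras large enough to contain all algebras constructed here (matrix algebras, algebras of compact operators, $B[0,1]$, etc.), in which every algebra homomorphism $f:A\to B$ gives a morphism (compatibly with composition and identities), such that: (1) each corner embedding $(A,\alpha)\to(M_n\otimes A,\gamma\otimes\alpha)$ is invertible in $\Lambda$ for all admissible cardinalities $n$, where the admissible cardinalities are either all cardinalities or those up to some cardinality $\chi$, and include at least all finite $n$; (2) for every algebra homomorphism (diffeotopy) $f:A\to B[0,1]:=B\otimes C^\infty([0,1],\mathbb{C})$ the evaluations at the endpoints satisfy $f_0=f_1$ in $\Lambda$.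
   Formalization: B is assumed left faithful (bB=0 implies b=0), as the identifications Θ_B(B)=B and M_n⊗B≅K_B(Bⁿ) presuppose; without it the claim fails already for E=0. That K_B(E⊕B) is quadratik, so an object of Λ, is stated explicitly. *)

(* Defs.v *)
From HB Require Import structures.
From mathcomp Require Import all_boot all_order all_algebra.
From mathcomp Require Import finmap complex.
From mathcomp Require Import all_classical all_reals all_analysis.

Set Implicit Arguments.
Unset Strict Implicit.
Unset Printing Implicit Defensive.

Import Order.TTheory GRing.Theory Num.Theory.
Import numFieldNormedType.Exports.

Local Open Scope classical_set_scope.
Local Open Scope ring_scope.

Definition is_lin (K : pzRingType) (V W : lmodType K) (f : V -> W) :=
  forall c u v, f (c *: u + v) = c *: f u + f v.

Section is_lin.
Variables (K : pzRingType) (V W : lmodType K) (f : V -> W).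
Hypothesis f_lin : is_lin f.

Lemma is_linD u v : f (u + v) = f u + f v.
Proof. by rewrite -[u in LHS]scale1r f_lin scale1r. Qed.

Lemma is_lin0 : f 0 = 0.
Proof. by apply: (addrI (f 0)); rewrite -is_linD !addr0. Qed.

Lemma is_linZ c u : f (c *: u) = c *: f u.
Proof. by rewrite -[c *: u]addr0 f_lin is_lin0 addr0. Qed.

Lemma is_lin_sum (J : Type) (r : seq J) (F : J -> V) :
  f (\sum_(i <- r) F i) = \sum_(i <- r) f (F i).
Proof.
elim: r => [|i r IH]; first by rewrite !big_nil is_lin0.
by rewrite !big_cons is_linD IH.
Qed.

End is_lin.

(** * Linear subspaces given by a proposition *)

Record lsubspace (K : pzRingType) (V : lmodType K) := LSubspace {
  lsub_pred : V -> Prop;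
  lsub0 : lsub_pred 0;
  lsubP : forall c u v,
    lsub_pred u -> lsub_pred v -> lsub_pred (c *: u + v) }.

Section lsubspace_type.
Variables (K : pzRingType) (V : lmodType K) (S : lsubspace V).

Definition lsub_mem : {pred V} := fun x => `[< lsub_pred S x >].

Lemma lsub_mem_closed : submod_closed lsub_mem.
Proof.
split; first by apply/asboolP; exact: lsub0.
by move=> c u v /asboolP Su /asboolP Sv; apply/asboolP; exact: lsubP.
Qed.

Record lsub_of := LSubOf { lsub_val : V; lsub_valP : lsub_val \in lsub_mem }.

HB.instance Definition _ := [isSub for lsub_val].
HB.instance Definition _ := [Choice of lsub_of by <:].
HB.instance Definition _ := GRing.SubChoice_isSubLmodule.Build K V lsub_mem
  lsub_of (GRing.submod_closed_semi lsub_mem_closed).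

Definition mklsub (x : V) (Sx : lsub_pred S x) : lsub_of := LSubOf (asboolT Sx).

Lemma lsub_in (x : lsub_of) : lsub_pred S (lsub_val x).
Proof. exact/asboolP/lsub_valP. Qed.

Lemma lsub_inj (x y : lsub_of) : lsub_val x = lsub_val y -> x = y.
Proof. exact: val_inj. Qed.

Lemma lsub_valL : is_lin lsub_val.
Proof. by []. Qed.

Lemma lsub_valD (x y : lsub_of) : lsub_val (x + y) = lsub_val x + lsub_val y.
Proof. exact: is_linD lsub_valL _ _. Qed.

Lemma lsub_valZ c (x : lsub_of) : lsub_val (c *: x) = c *: lsub_val x.
Proof. exact: is_linZ lsub_valL _ _. Qed.

Lemma lsub_val0 : lsub_val (0 : lsub_of) = 0.
Proof. exact: is_lin0 lsub_valL. Qed.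

Lemma lsub_val_sum (J : Type) (r : seq J) (F : J -> lsub_of) :
  lsub_val (\sum_(i <- r) F i) = \sum_(i <- r) lsub_val (F i).
Proof. exact: is_lin_sum lsub_valL _ _ _. Qed.

End lsubspace_type.

(** * Finitely supported families *)

Section families.
Variables (K : pzRingType) (I : choiceType) (V : lmodType K).

Definition finitely_supported (x : I -> V) := finite_set [set i | x i != 0].

Lemma finitely_supportedP (x : I -> V) :
  finitely_supported x <->
  exists A : {fset I}, forall i, i \notin A -> x i = 0.
Proof.
split=> [/finite_fsetP[A xA]|[A xA]].
  exists A => i iA; apply/eqP; apply: contraNT iA => xi0.
  by have : [set` A] i by rewrite -xA.
apply: (sub_finite_set _ (finite_fset A)) => i /= xi0.
by apply: contraNT xi0 => /xA ->.
Qed.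

Lemma finitely_supported0 : finitely_supported 0.
Proof. by apply/finitely_supportedP; exists fset0. Qed.

Lemma finitely_supportedL c (x y : I -> V) :
  finitely_supported x -> finitely_supported y ->
  finitely_supported (c *: x + y).
Proof.
move=> /finitely_supportedP[A xA] /finitely_supportedP[B yB].
apply/finitely_supportedP; exists (A `|` B)%fset => i.
rewrite in_fsetU negb_or => /andP[/xA xi /yB yi].
by rewrite addrfctE scalrfctE xi yi scaler0 addr0.
Qed.

Definition fam_space : lsubspace (I -> V) :=
  LSubspace finitely_supported0 finitely_supportedL.

Definition fam := lsub_of fam_space.
HB.instance Definition _ := GRing.Lmodule.on fam.

Definition coef (x : fam) : I -> V := lsub_val x.

Definition mkfam (x : I -> V) (xf : finitely_supported x) : fam :=
  @mklsub _ _ fam_space x xf.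

Lemma fam_inj (x y : fam) : coef x =1 coef y -> x = y.
Proof. by move=> xy; apply: lsub_inj; apply/funext. Qed.

Lemma fam_supp (x : fam) :
  exists A : {fset I}, forall i, i \notin A -> coef x i = 0.
Proof. exact/finitely_supportedP/(lsub_in x). Qed.

Lemma coefD (x y : fam) i : coef (x + y) i = coef x i + coef y i.
Proof. by rewrite /coef lsub_valD. Qed.

Lemma coefZ c (x : fam) i : coef (c *: x) i = c *: coef x i.
Proof. by rewrite /coef lsub_valZ. Qed.

Lemma coef0 i : coef 0 i = 0.
Proof. by rewrite /coef lsub_val0. Qed.

Lemma coef_sum (J : Type) (r : seq J) (F : J -> fam) i :
  coef (\sum_(j <- r) F j) i = \sum_(j <- r) coef (F j) i.
Proof. by rewrite /coef lsub_val_sum fct_sumE. Qed.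

End families.
Arguments coef : simpl never.

Section tensor.
Variables (K : comNzRingType) (I : choiceType).

(* The free module [K^n], [n] being the cardinality of [I]. *)
Definition free := fam I (K^o).
HB.instance Definition _ := GRing.Lmodule.on free.

Lemma basis_supp (i : I) :
  @finitely_supported K I (K^o) (fun j => (j == i)%:R).
Proof.
apply/finitely_supportedP; exists [fset i]%fset => j.
by rewrite in_fset1 => /negPf ->.
Qed.

Definition basis (i : I) : free := mkfam (basis_supp i).

Lemma elt_supp (V : lmodType K) (v : free) (a : V) :
  finitely_supported (fun i => (coef v i : K) *: a).
Proof.
have [A vA] := fam_supp v; apply/finitely_supportedP.
by exists A => i /vA ->; rewrite scale0r.
Qed.

(* The elementary tensor [v (x) a] in [K^n (x) V], the latter being identified
   with the finitely supported families in [V]. *)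
Definition elt (V : lmodType K) (v : free) (a : V) : fam I V :=
  mkfam (elt_supp v a).

(* The tensor product of maps, [sum_i e_i (x) x_i |-> sum_i d e_i (x) a x_i]. *)
Definition tens (V W : lmodType K) (d : free -> free) (a : V -> W)
    (x : fam I V) : fam I W :=
  \sum_(i \in [set: I]) elt (d (basis i)) (a (coef x i)).

Section theory.
Variable V : lmodType K.

Lemma coef_elt (v : free) (a : V) i : coef (elt v a) i = (coef v i : K) *: a.
Proof. by []. Qed.

Lemma coef_basis (i j : I) : coef (basis i) j = (j == i)%:R.
Proof. by []. Qed.

Lemma eltDl c (v w : free) (a : V) :
  elt (c *: v + w) a = c *: elt v a + elt w a.
Proof.
apply: fam_inj => i.
by rewrite !(coefD, coefZ, coef_elt) scalerDl scalerA.
Qed.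

Lemma eltDr c (v : free) (a b : V) :
  elt v (c *: a + b) = c *: elt v a + elt v b.
Proof.
apply: fam_inj => i.
by rewrite !(coefD, coefZ, coef_elt) scalerDr !scalerA mulrC.
Qed.

Lemma elt0 (v : free) : elt v (0 : V) = 0.
Proof. exact: (is_lin0 (fun c => eltDr c v)). Qed.

Lemma eltZ c (v : free) (a : V) : elt (c *: v) a = elt v (c *: a).
Proof.
by apply: fam_inj => i; rewrite !(coefZ, coef_elt) scalerA [_ * c]mulrC.
Qed.

Lemma coef_sum_basis (A : {fset I}) (x : I -> V) :
  (forall i, i \notin A -> x i = 0) ->
  forall j, \sum_(i <- A) (j == i)%:R *: x i = x j.
Proof.
move=> xA j; have [jA|jA] := boolP (j \in A); last first.
  rewrite xA// big_seq big1// => i iA; case: eqP => [ji|_].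
    by move: jA; rewrite ji iA.
  by rewrite scale0r.
rewrite (big_fsetD1 j)//= eqxx scale1r big_seq big1 ?addr0// => i.
by rewrite in_fsetD1 eq_sym => /andP[/negPf -> _]; rewrite scale0r.
Qed.

Lemma fam_decomp (A : {fset I}) (x : fam I V) :
  (forall i, i \notin A -> coef x i = 0) ->
  x = \sum_(i <- A) elt (basis i) (coef x i).
Proof.
move=> xA; apply: fam_inj => j; rewrite coef_sum.
under eq_bigr do rewrite coef_elt coef_basis.
by rewrite (coef_sum_basis xA).
Qed.

End theory.

Lemma tensE (V W : lmodType K) (d : free -> free) (a : V -> W) (A : {fset I}) (x : fam I V) :
  a 0 = 0 -> (forall i, i \notin A -> coef x i = 0) ->
  tens d a x = \sum_(i <- A) elt (d (basis i)) (a (coef x i)).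
Proof.
move=> a0 xA; rewrite /tens (fsbigTE A)// => i /xA ->.
by rewrite a0 elt0.
Qed.

Lemma tens_lin (V W : lmodType K) (d : free -> free) (a : V -> W) :
  is_lin a -> is_lin (tens d a).
Proof.
move=> al c x y.
have [A xA] := fam_supp x; have [B yB] := fam_supp y.
have a0 := is_lin0 al.
have xAB i : i \notin (A `|` B)%fset -> coef x i = 0.
  by rewrite in_fsetU negb_or => /andP[/xA].
have yAB i : i \notin (A `|` B)%fset -> coef y i = 0.
  by rewrite in_fsetU negb_or => /andP[_ /yB].
rewrite !(tensE d a0 xAB, tensE d a0 yAB) (@tensE _ _ d a (A `|` B)%fset)//.
  rewrite scaler_sumr -big_split; apply: eq_bigr => i _ /=.
  by rewrite coefD coefZ al eltDr.
by move=> i iAB; rewrite coefD coefZ xAB// yAB// scaler0 addr0.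
Qed.

Lemma tens_elt (V W : lmodType K) (d : free -> free) (a : V -> W) v b :
  is_lin d -> is_lin a -> tens d a (elt v b) = elt (d v) (a b).
Proof.
move=> dl al; have [A vA] := fam_supp v.
rewrite (@tensE _ _ d a A) ?(is_lin0 al)//; last first.
  by move=> i /vA vi; rewrite coef_elt vi scale0r.
rewrite [v in RHS](fam_decomp vA) (is_lin_sum dl).
rewrite (is_lin_sum (fun c u w => eltDl c u w (a b))).
apply: eq_bigr => i _. rewrite coef_elt (is_linZ al) -eltZ; congr elt.
rewrite -(is_linZ dl); congr d.
by apply: fam_inj => j; rewrite coefZ coef_elt /= /GRing.scale/= mulrC.
Qed.

Lemma tens_id (V : lmodType K) (d : free -> free) (a : V -> V) (x : fam I V) :
  (forall v, d v = v) -> (forall b, a b = b) -> tens d a x = x.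
Proof.
move=> d1 a1; have [A xA] := fam_supp x.
rewrite (tensE d (a1 0) xA) [RHS](fam_decomp xA).
by apply: eq_bigr => i _; rewrite d1 a1.
Qed.

Lemma tens_comp (U V W : lmodType K) (d d' : free -> free)
    (a : V -> W) (a' : U -> V) (x : fam I U) :
  is_lin d -> is_lin a -> is_lin a' ->
  tens d a (tens d' a' x) = tens (d \o d') (a \o a') x.
Proof.
move=> dl al al'; have [A xA] := fam_supp x.
rewrite (tensE d' (is_lin0 al') xA) (is_lin_sum (tens_lin d al)).
rewrite (@tensE _ _ (d \o d') (a \o a') A)//; last first.
  by rewrite /= (is_lin0 al') (is_lin0 al).
by apply: eq_bigr => i _; rewrite tens_elt.
Qed.

Lemma eq_tens (V W : lmodType K) (d d' : free -> free) (a a' : V -> W) x :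
  d =1 d' -> a =1 a' -> tens d a x = tens d' a' x.
Proof. by move=> /funext -> /funext ->. Qed.

End tensor.

(** * Algebras with a group action *)

Section algebras.
Variables (R : realType) (G : groupType).
Local Notation C := R[i].

Record algebra := Algebra {
  alg_car :> lmodType C;
  amul : alg_car -> alg_car -> alg_car;
  amulA : forall x y z, amul x (amul y z) = amul (amul x y) z;
  amulDl : forall x y z, amul (x + y) z = amul x z + amul y z;
  amulDr : forall x y z, amul x (y + z) = amul x y + amul x z;
  amulZl : forall c x y, amul (c *: x) y = c *: amul x y;
  amulZr : forall c x y, amul x (c *: y) = c *: amul x y }.

(* An action of [G] by algebra automorphisms, i.e. a group homomorphism
   [G -> Aut(A)]; bijectivity of each [act g] follows from [gact1] and [gactM]. *)
Record gaction (A : algebra) := GAction {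
  gact_fun :> G -> A -> A;
  gactL : forall g, is_lin (gact_fun g);
  gact_mul : forall g x y,
    gact_fun g (amul x y) = amul (gact_fun g x) (gact_fun g y);
  gact1 : forall x, gact_fun 1%g x = x;
  gactM : forall g h x, gact_fun (g * h)%g x = gact_fun g (gact_fun h x) }.

Record galgebra := GAlgebra { galg :> algebra; gact : gaction galg }.

(* Equivariant algebra homomorphisms. *)
Record ghom (A B : galgebra) := GHom {
  ghom_fun :> A -> B;
  ghomL : is_lin ghom_fun;
  ghom_mul : forall x y, ghom_fun (amul x y) = amul (ghom_fun x) (ghom_fun y);
  ghom_act : forall g x, ghom_fun (gact A g x) = gact B g (ghom_fun x) }.

Definition ghom_id (A : galgebra) : ghom A A :=
  @GHom A A id (fun _ _ _ => erefl) (fun _ _ => erefl) (fun _ _ => erefl).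

Section ghom_comp.
Variables (A B D : galgebra) (f : ghom B D) (h : ghom A B).

Lemma ghom_compL : is_lin (fun x => f (h x)).
Proof. by move=> c u v; rewrite !ghomL. Qed.

Lemma ghom_comp_mul x y : f (h (amul x y)) = amul (f (h x)) (f (h y)).
Proof. by rewrite !ghom_mul. Qed.

Lemma ghom_comp_act g x : f (h (gact A g x)) = gact D g (f (h x)).
Proof. by rewrite !ghom_act. Qed.

Definition ghom_comp : ghom A D :=
  @GHom A D (fun x => f (h x)) ghom_compL ghom_comp_mul ghom_comp_act.

End ghom_comp.

Definition quadratik (A : algebra) := forall a : A,
  exists (J : finType) (x y : J -> A), a = \sum_j amul (x j) (y j).

(* [A] embeds in [Hom_A(A, A)] by left multiplication; equivalently, for
   nonempty [n], the canonical map [M_n(A) -> K_A(A^n)] is an isomorphism. *)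
Definition left_faithful (A : algebra) := injective (@amul A).

Section algebra_theory.
Variable A : algebra.
Implicit Types x y : A.

Lemma amulLl y : is_lin (fun x => amul x y).
Proof. by move=> c u v; rewrite amulDl amulZl. Qed.

Lemma amulLr x : is_lin (amul x).
Proof. by move=> c u v; rewrite amulDr amulZr. Qed.

Lemma amul0l y : amul 0 y = 0.
Proof. exact: is_lin0 (amulLl y). Qed.

Lemma amul0r x : amul x 0 = 0.
Proof. exact: is_lin0 (amulLr x). Qed.

Lemma amul_suml (J : Type) (r : seq J) (F : J -> A) y :
  amul (\sum_(i <- r) F i) y = \sum_(i <- r) amul (F i) y.
Proof. exact: is_lin_sum (amulLl y) _ _ _. Qed.

Lemma amul_sumr (J : Type) (r : seq J) (F : J -> A) x :
  amul x (\sum_(i <- r) F i) = \sum_(i <- r) amul x (F i).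
Proof. exact: is_lin_sum (amulLr x) _ _ _. Qed.

Lemma is_lin_mul_sum (f : A -> A) (J J' : Type) (r : seq J) (r' : seq J')
    (F : J -> A) (F' : J' -> A) : is_lin f ->
  (forall i j, f (amul (F i) (F' j)) = amul (f (F i)) (f (F' j))) ->
  f (amul (\sum_(i <- r) F i) (\sum_(j <- r') F' j)) =
  amul (f (\sum_(i <- r) F i)) (f (\sum_(j <- r') F' j)).
Proof.
move=> fl fM; rewrite !(amul_suml, is_lin_sum fl); apply: eq_bigr => i _.
by rewrite !(amul_sumr, is_lin_sum fl); apply: eq_bigr => j _.
Qed.

End algebra_theory.

(** * Matrix algebras *)

Section matrices.
Variables (I : choiceType) (A : algebra).
Local Notation mat := (fam (I * I)%type A).
Implicit Types x y z : mat.

Lemma mat_supp x : exists D : {fset I}, forall i j,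
  (i \notin D) || (j \notin D) -> coef x (i, j) = 0.
Proof.
have [P xP] := fam_supp x.
exists ([fset p.1 | p in P] `|` [fset p.2 | p in P])%fset => i j ij.
apply: xP; apply/negP => ijP; move: ij; rewrite !in_fsetU !negb_or.
have -> : i \in [fset p.1 | p in P]%fset by apply/imfsetP; exists (i, j).
have -> : j \in [fset p.2 | p in P]%fset by apply/imfsetP; exists (i, j).
by rewrite /= andbF.
Qed.

Definition mat_mul_coef (x y : I * I -> A) (p : I * I) : A :=
  \sum_(j \in [set: I]) amul (x (p.1, j)) (y (j, p.2)).

Lemma mat_mul_coefE x y (D : {fset I}) i k :
  (forall j, j \notin D -> coef x (i, j) = 0 \/ coef y (j, k) = 0) ->
  mat_mul_coef (coef x) (coef y) (i, k) =
  \sum_(j <- D) amul (coef x (i, j)) (coef y (j, k)).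
Proof.
move=> xyD; apply: fsbigTE => j /xyD[] ->; first by rewrite amul0l.
by rewrite amul0r.
Qed.

Lemma mat_mul_supp x y : finitely_supported (mat_mul_coef (coef x) (coef y)).
Proof.
have [D xD] := mat_supp x; have [E yE] := mat_supp y.
apply/finitely_supportedP; exists (D `*` E)%fset => -[i k].
rewrite in_fsetM /= => ik; rewrite (@mat_mul_coefE _ _ D); last first.
  by move=> j jD; left; rewrite xD// jD orbT.
rewrite big1// => j _; move: ik; rewrite negb_and => /orP[iD|kE].
  by rewrite xD ?iD// amul0l.
by rewrite yE ?kE ?orbT// amul0r.
Qed.

Definition mat_mul x y : mat := mkfam (mat_mul_supp x y).

Lemma mat_mulE x y (D : {fset I}) i k :
  (forall j, j \notin D -> coef x (i, j) = 0 \/ coef y (j, k) = 0) ->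
  coef (mat_mul x y) (i, k) =
  \sum_(j <- D) amul (coef x (i, j)) (coef y (j, k)).
Proof. exact: mat_mul_coefE. Qed.

Lemma mat_mulA x y z : mat_mul x (mat_mul y z) = mat_mul (mat_mul x y) z.
Proof.
have [D xD] := mat_supp x; have [E zE] := mat_supp z.
apply: fam_inj => -[i l].
rewrite (@mat_mulE _ _ D); last by move=> j jD; left; rewrite xD ?jD ?orbT.
rewrite [RHS](@mat_mulE _ _ E); last by move=> j jD; right; rewrite zE ?jD.
under eq_bigr => j _.
  rewrite (@mat_mulE _ _ E); last by move=> k kE; right; rewrite zE ?kE.
  rewrite amul_sumr; over.
rewrite exchange_big; apply: eq_bigr => k _.
rewrite (@mat_mulE _ _ D); last by move=> j jD; left; rewrite xD ?jD ?orbT.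
by rewrite amul_suml; apply: eq_bigr => j _; rewrite amulA.
Qed.

Lemma mat_mulLl y : is_lin (fun x => mat_mul x y).
Proof.
move=> c u v; have [D yD] := mat_supp y; apply: fam_inj => -[i k].
have yDj (w : mat) j : j \notin D -> coef w (i, j) = 0 \/ coef y (j, k) = 0.
  by move=> jD; right; rewrite yD ?jD.
rewrite coefD coefZ !(mat_mulE (yDj _)) scaler_sumr -big_split.
by apply: eq_bigr => j _; rewrite coefD coefZ amulLl.
Qed.

Lemma mat_mulLr x : is_lin (mat_mul x).
Proof.
move=> c u v; have [D xD] := mat_supp x; apply: fam_inj => -[i k].
have xDj (w : mat) j : j \notin D -> coef x (i, j) = 0 \/ coef w (j, k) = 0.
  by move=> jD; left; rewrite xD ?jD ?orbT.
rewrite coefD coefZ !(mat_mulE (xDj _)) scaler_sumr -big_split.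
by apply: eq_bigr => j _; rewrite coefD coefZ amulLr.
Qed.

(* [M_n(A)], identified with [M_n (x) A]. *)
Definition mat_alg : algebra := @Algebra mat mat_mul mat_mulA
  (fun x y z => is_linD (mat_mulLl z) x y)
  (fun x y z => is_linD (mat_mulLr x) y z)
  (fun c x y => is_linZ (mat_mulLl y) c x)
  (fun c x y => is_linZ (mat_mulLr x) c y).

End matrices.

Definition complex_alg : algebra := @Algebra (C^o : lmodType C)
  (fun x y : C => x * y)
  (@mulrA C) (@mulrDl C) (@mulrDr C)
  (fun c x y => esym (mulrA c x y)) (fun c x y => mulrCA x c y).

Section tensor_action.
Variables (I : choiceType) (A : galgebra).

Lemma mat_mul_elt (v w : mat_alg I complex_alg) (a b : A) :
  amul (elt v a : mat_alg I A) (elt w b) = elt (amul v w) (amul a b).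
Proof.
have [D vD] := mat_supp v; apply: fam_inj => -[i k].
rewrite coef_elt (@mat_mulE I A _ _ D); last first.
  by move=> j jD; left; rewrite coef_elt vD ?jD ?orbT// scale0r.
rewrite (@mat_mulE I complex_alg _ _ D); last first.
  by move=> j jD; left; rewrite vD ?jD ?orbT.
rewrite scaler_suml; apply: eq_bigr => j _.
by rewrite !coef_elt amulZl amulZr scalerA.
Qed.

Variable gamma : gaction (mat_alg I complex_alg).

Lemma gamma_lin g : @is_lin C (free C (I * I)%type) (free C (I * I)%type) (gamma g).
Proof. exact (gactL gamma g). Qed.

Definition mat_act (g : G) : mat_alg I A -> mat_alg I A :=
  tens (gamma g) (gact A g).

Lemma mat_act_lin g : is_lin (mat_act g).
Proof. exact/tens_lin/gactL. Qed.

Lemma mat_act_mul g x y :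
  mat_act g (amul x y) = amul (mat_act g x) (mat_act g y).
Proof.
have [D xD] := fam_supp x; have [E yE] := fam_supp y.
have sumx : x = \sum_(i <- D) elt (basis R[i] i) (coef x i) := fam_decomp xD.
have sumy : y = \sum_(i <- E) elt (basis R[i] i) (coef y i) := fam_decomp yE.
rewrite sumx sumy.
have key := @is_lin_mul_sum (mat_alg I A) (mat_act g) _ _
  (enum_fset D) (enum_fset E) (fun i => elt (basis R[i] i) (coef x i))
  (fun i => elt (basis R[i] i) (coef y i)) (mat_act_lin g).
apply: key => i j.
have gl := gamma_lin g; have al := gactL (gact A) g.
rewrite mat_mul_elt /mat_act !tens_elt//.
by rewrite mat_mul_elt !gact_mul.
Qed.

Lemma mat_act1 x : mat_act 1%g x = x.
Proof. by apply: tens_id => ?; rewrite gact1. Qed.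

Lemma mat_actM g h x : mat_act (g * h)%g x = mat_act g (mat_act h x).
Proof.
have gl := gamma_lin g; have al := gactL (gact A).
rewrite /mat_act tens_comp//.
by apply: eq_tens => ?; rewrite gactM.
Qed.

(* [(M_n (x) A, gamma (x) alpha)] *)
Definition mat_galg : galgebra :=
  @GAlgebra (mat_alg I A) (GAction mat_act_lin mat_act_mul mat_act1 mat_actM).

End tensor_action.

(** * The algebra [B[0,1] = B (x) C^oo([0,1], C)] *)

(* A function on [[0,1]] is smooth iff it is the restriction of a smooth
   function on the line, so [smooth] is stated for functions on [R]. *)
Definition smooth_real (f : R -> R) :=
  forall n x, derivable (derive1n n f) x 1.

Definition smooth (f : R -> C) :=
  smooth_real (fun t => complex.Re (f t)) /\ smooth_real (fun t => complex.Im (f t)).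

Lemma smooth_realS (f : R -> R) :
  smooth_real f <-> (forall x, derivable f x 1) /\ smooth_real (derive1 f).
Proof.
split=> [fs|[f1 fs] [|n] x]; first split.
- by move=> x; exact: (fs 0%N x).
- by move=> n x; have := fs n.+1 x; rewrite /derive1n iterSr.
- exact: f1.
- by rewrite /derive1n iterSr; exact: fs.
Qed.

Lemma smooth_real_coind (P : (R -> R) -> Prop) :
  (forall f, P f -> (forall x, derivable f x 1) /\ P (derive1 f)) ->
  forall f, P f -> smooth_real f.
Proof.
move=> PS f Pf n; elim: n f Pf => [|n IH] f Pf x.
  by have [+ _] := PS f Pf; apply.
by rewrite /derive1n iterSr; apply: IH; have [] := PS f Pf.
Qed.

Lemma smooth_realD (f g : R -> R) :
  smooth_real f -> smooth_real g -> smooth_real (f + g).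
Proof.
move=> fs gs; pose P h := exists f g : R -> R,
  [/\ smooth_real f, smooth_real g & h = f + g].
apply: (@smooth_real_coind P); last by exists f, g.
move=> h [u [v [/smooth_realS[u1 us] /smooth_realS[v1 vs] ->]]]; split.
  by move=> x; apply: derivableD; [exact: u1|exact: v1].
exists (derive1 u), (derive1 v); split => //; apply/funext => x.
by rewrite derive1E deriveD -?derive1E.
Qed.

Lemma smooth_realN (f : R -> R) : smooth_real f -> smooth_real (- f).
Proof.
move=> fs; pose P h := exists2 f : R -> R, smooth_real f & h = - f.
apply: (@smooth_real_coind P); last by exists f.
move=> h [u /smooth_realS[u1 us] ->]; split.
  by move=> x; apply: derivableN; exact: u1.
exists (derive1 u) => //; apply/funext => x.
by rewrite derive1E deriveN -?derive1E.
Qed.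

Inductive smooth_products : (R -> R) -> Prop :=
| SmoothMul u v : smooth_real u -> smooth_real v -> smooth_products (u * v)
| SmoothAdd h k :
    smooth_products h -> smooth_products k -> smooth_products (h + k).

Lemma smooth_realM (f g : R -> R) :
  smooth_real f -> smooth_real g -> smooth_real (f * g).
Proof.
move=> fs gs; apply: (@smooth_real_coind smooth_products); last first.
  exact: SmoothMul.
move=> h; elim=> {h} [u v us vs|h k _ [h1 hs] _ [k1 ks]].
  have [u1 u1s] := (smooth_realS u).1 us.
  have [v1 v1s] := (smooth_realS v).1 vs.
  split=> [x|]; first by apply: derivableM; [exact: u1|exact: v1].
  have -> : derive1 (u * v) = u * derive1 v + v * derive1 u.
    apply/funext => y.
    by rewrite derive1E deriveM -?derive1E.
  by apply: SmoothAdd; apply: SmoothMul.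
split=> [x|]; first by apply: derivableD; [exact: h1|exact: k1].
have -> : derive1 (h + k) = derive1 h + derive1 k.
  apply/funext => y.
  by rewrite derive1E deriveD -?derive1E.
exact: SmoothAdd.
Qed.

Lemma smoothM (f g : R -> C) :
  smooth f -> smooth g -> smooth (fun t => f t * g t).
Proof.
move=> [fr fi] [gr gi]; split.
- have -> : (fun t => complex.Re (f t * g t)) =
      (fun t => complex.Re (f t)) * (fun t => complex.Re (g t)) -
      (fun t => complex.Im (f t)) * (fun t => complex.Im (g t)).
    apply/funext => t; rewrite addrfctE opprfctE !mulrfctE.
    by case: (f t) (g t) => [? ?] [].
  by apply: smooth_realD; [|apply: smooth_realN]; apply: smooth_realM.
- have -> : (fun t => complex.Im (f t * g t)) =
      (fun t => complex.Re (f t)) * (fun t => complex.Im (g t)) +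
      (fun t => complex.Im (f t)) * (fun t => complex.Re (g t)).
    apply/funext => t; rewrite addrfctE !mulrfctE.
    by case: (f t) (g t) => [? ?] [].
  by apply: smooth_realD; apply: smooth_realM.
Qed.

Definition unit_interval := {t : R | 0 <= t <= 1}.

Lemma ui0_subproof : 0 <= (0 : R) <= 1.
Proof. by rewrite lexx ler01. Qed.

Lemma ui1_subproof : 0 <= (1 : R) <= 1.
Proof. by rewrite ler01 lexx. Qed.

Definition ui0 : unit_interval := exist _ 0 ui0_subproof.
Definition ui1 : unit_interval := exist _ 1 ui1_subproof.

Section paths.
Variable A : galgebra.
Implicit Types F : unit_interval -> A.

(* The image of the injective map
   [A (x) C^oo([0,1], C) -> (unit_interval -> A)], [a (x) f |-> f(.) a]. *)
Definition smooth_path F := exists (J : finType) (f : J -> R -> C) (a : J -> A),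
  (forall j, smooth (f j)) /\ F = fun t => \sum_j f j (val t) *: a j.

Lemma smooth_path0 : smooth_path 0.
Proof.
exists void, (fun _ _ => 0), (fun _ => 0); split => [[]|].
by apply/funext => t; rewrite big_pred0// => -[].
Qed.

Lemma smooth_pathL c F F' :
  smooth_path F -> smooth_path F' -> smooth_path (c *: F + F').
Proof.
move=> [J [f [a [fs ->]]]] [J' [f' [a' [fs' ->]]]].
exists (J + J')%type.
exists (fun j => match j with inl j => f j | inr j => f' j end).
exists (fun j => match j with inl j => c *: a j | inr j => a' j end).
split=> [[]//|]; apply/funext => t.
rewrite addrfctE scalrfctE big_sumType /= scaler_sumr; congr (_ + _).
by apply: eq_bigr => j _; rewrite !scalerA mulrC.
Qed.

Lemma smooth_path_mul F F' : smooth_path F -> smooth_path F' ->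
  smooth_path (fun t => amul (F t) (F' t)).
Proof.
move=> [J [f [a [fs ->]]]] [J' [f' [a' [fs' ->]]]].
exists (J * J')%type, (fun p t => f p.1 t * f' p.2 t).
exists (fun p => amul (a p.1) (a' p.2)); split=> [p|]; first exact: smoothM.
apply/funext => t; rewrite amul_suml.
rewrite -(pair_bigA _ (fun i j => (f i (val t) * f' j (val t)) *:
  amul (a i) (a' j))) /=.
apply: eq_bigr => i _; rewrite amul_sumr; apply: eq_bigr => j _.
by rewrite amulZl amulZr scalerA.
Qed.

Lemma smooth_path_act g F :
  smooth_path F -> smooth_path (fun t => gact A g (F t)).
Proof.
move=> [J [f [a [fs ->]]]]; exists J, f, (fun j => gact A g (a j)).
split=> //; apply/funext => t; rewrite (is_lin_sum (gactL _ g)).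
by apply: eq_bigr => j _; rewrite (is_linZ (gactL _ g)).
Qed.

Definition path_space : lsubspace (unit_interval -> A) :=
  LSubspace smooth_path0 smooth_pathL.

Local Notation path := (lsub_of path_space).

Definition path_eval (t : unit_interval) (F : path) : A := lsub_val F t.

Lemma path_evalL t : is_lin (path_eval t).
Proof. by []. Qed.

Lemma path_inj (x y : path) : (forall t, path_eval t x = path_eval t y) -> x = y.
Proof. by move=> xy; apply: lsub_inj; apply/funext. Qed.

Definition path_mul (x y : path) : path :=
  @mklsub _ _ path_space _ (smooth_path_mul (lsub_in x) (lsub_in y)).

Definition path_act (g : G) (x : path) : path :=
  @mklsub _ _ path_space _ (smooth_path_act g (lsub_in x)).

Lemma path_evalM t x y :
  path_eval t (path_mul x y) = amul (path_eval t x) (path_eval t y).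
Proof. by []. Qed.

Lemma path_eval_act t g x : path_eval t (path_act g x) = gact A g (path_eval t x).
Proof. by []. Qed.

Lemma path_mulA x y z : path_mul x (path_mul y z) = path_mul (path_mul x y) z.
Proof. by apply: path_inj => t; rewrite !path_evalM amulA. Qed.

Lemma path_mulLl y : is_lin (fun x => path_mul x y).
Proof.
by move=> c u v; apply: path_inj => t; rewrite path_evalL !path_evalM amulLl.
Qed.

Lemma path_mulLr x : is_lin (path_mul x).
Proof.
by move=> c u v; apply: path_inj => t; rewrite path_evalL !path_evalM amulLr.
Qed.

Definition path_alg : algebra := @Algebra path path_mul path_mulA
  (fun x y z => is_linD (path_mulLl z) x y)
  (fun x y z => is_linD (path_mulLr x) y z)
  (fun c x y => is_linZ (path_mulLl y) c x)
  (fun c x y => is_linZ (path_mulLr x) c y).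

Lemma path_actL g : is_lin (path_act g : path_alg -> path_alg).
Proof.
by move=> c u v; apply: path_inj => t; rewrite path_evalL !path_eval_act gactL.
Qed.

Lemma path_act_mul g (x y : path_alg) :
  path_act g (amul x y) = amul (path_act g x : path_alg) (path_act g y).
Proof.
by apply: path_inj => t; rewrite !(path_eval_act, path_evalM) gact_mul.
Qed.

Lemma path_act1 x : path_act 1%g x = x.
Proof. by apply: path_inj => t; rewrite path_eval_act gact1. Qed.

Lemma path_actM g h x : path_act (g * h)%g x = path_act g (path_act h x).
Proof. by apply: path_inj => t; rewrite !path_eval_act gactM. Qed.

Definition path_galg : galgebra :=
  @GAlgebra path_alg (GAction path_actL path_act_mul path_act1 path_actM).

Definition ghom_eval (t : unit_interval) : ghom path_galg A :=
  @GHom path_galg A (path_eval t) (path_evalL t) (path_evalM t)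
    (fun g x => path_eval_act t g x).

End paths.

(** * Functional modules *)

Section modules.
Variable A : galgebra.

Record rmodule := RModule {
  rmod_car :> lmodType C;
  rmul : rmod_car -> A -> rmod_car;
  rmulA : forall x a b, rmul x (amul a b) = rmul (rmul x a) b;
  rmulDl : forall x y a, rmul (x + y) a = rmul x a + rmul y a;
  rmulDr : forall x a b, rmul x (a + b) = rmul x a + rmul x b;
  rmulZl : forall c x a, rmul (c *: x) a = c *: rmul x a;
  rmulZr : forall c x a, rmul x (c *: a) = c *: rmul x a }.

Definition self_rmodule : rmodule :=
  @RModule A (@amul A) (fun x a b => amulA x a b)
    (@amulDl A) (@amulDr A) (@amulZl A) (@amulZr A).

Definition rmod_hom (M N : rmodule) (f : M -> N) :=
  (forall x y, f (x + y) = f x + f y) /\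
  (forall x a, f (rmul x a) = rmul (f x) a).

(* [fspace] is the functional space [Theta_A(M)]. *)
Record fmodule := FModule {
  fm_mod :> rmodule;
  fm_act : G -> fm_mod -> fm_mod;
  fm_actD : forall g x y, fm_act g (x + y) = fm_act g x + fm_act g y;
  fm_act1 : forall x, fm_act 1%g x = x;
  fm_actM : forall g h x, fm_act (g * h)%g x = fm_act g (fm_act h x);
  fm_act_rmul : forall g x a,
    fm_act g (rmul x a) = rmul (fm_act g x) (gact A g a);
  fspace : (fm_mod -> A) -> Prop;
  fspace_hom : forall phi, fspace phi -> @rmod_hom fm_mod self_rmodule phi;
  fspace0 : fspace (fun=> 0);
  fspaceB : forall phi psi, fspace phi -> fspace psi ->
    fspace (fun x => phi x - psi x);
  fspace_lmul : forall a phi, fspace phi -> fspace (fun x => amul a (phi x));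
  fspace_act : forall g phi, fspace phi ->
    fspace (fun x => gact A g (phi (fm_act g^-1%g x))) }.

Definition theta (M N : fmodule) (eta : N) (phi : M -> A) : M -> N :=
  fun x => rmul eta (phi x).

(* The elements of [K_A(M, N)]. *)
Definition compact (M N : fmodule) (k : M -> N) :=
  exists (J : finType) (eta : J -> N) (phi : J -> M -> A),
    (forall j, fspace (phi j)) /\ k = fun x => \sum_j theta (eta j) (phi j) x.

Section module_theory.
Variable M : rmodule.

Lemma rmulLl a : is_lin (fun x : M => rmul x a).
Proof. by move=> c u v; rewrite rmulDl rmulZl. Qed.

Lemma rmulLr (x : M) : is_lin (rmul x).
Proof. by move=> c u v; rewrite rmulDr rmulZr. Qed.

Lemma rmul_sumr (J : Type) (r : seq J) (F : J -> A) (x : M) :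
  rmul x (\sum_(i <- r) F i) = \sum_(i <- r) rmul x (F i).
Proof. exact: is_lin_sum (rmulLr x) _ _ _. Qed.

End module_theory.

Lemma rmod_hom_sum (M N : rmodule) (f : M -> N) (J : Type) (r : seq J)
    (F : J -> M) : rmod_hom f ->
  f (\sum_(i <- r) F i) = \sum_(i <- r) f (F i).
Proof.
move=> [fD _]; elim: r => [|i r IH]; last by rewrite !big_cons fD IH.
by rewrite !big_nil; apply: (addrI (f 0)); rewrite -fD !addr0.
Qed.

Section compact_operators.
Variable M : fmodule.
Implicit Types k : M -> M.

Lemma fm_act_sum g (J : Type) (r : seq J) (F : J -> M) :
  fm_act g (\sum_(i <- r) F i) = \sum_(i <- r) fm_act g (F i).
Proof.
elim: r => [|i r IH]; last by rewrite !big_cons fm_actD IH.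
by rewrite !big_nil; apply: (addrI (fm_act g 0)); rewrite -fm_actD !addr0.
Qed.

Lemma fm_actVK g (x : M) : fm_act g (fm_act g^-1%g x) = x.
Proof. by rewrite -fm_actM mulgV fm_act1. Qed.

Lemma fm_actKV g (x : M) : fm_act g^-1%g (fm_act g x) = x.
Proof. by rewrite -fm_actM mulVg fm_act1. Qed.

Lemma compact_hom k : @compact M M k -> @rmod_hom M M k.
Proof.
move=> [J [eta [phi [phiT ->]]]]; split=> [x y|x a].
  rewrite -big_split; apply: eq_bigr => j _ /=.
  by rewrite /theta (fspace_hom (phiT j)).1 rmulDr.
rewrite (is_lin_sum (rmulLl a)); apply: eq_bigr => j _.
by rewrite /theta (fspace_hom (phiT j)).2 rmulA.
Qed.

Lemma compactZ k k' c x :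
  @compact M M k -> @compact M M k' -> k (c *: k' x) = c *: k (k' x).
Proof.
move=> kC [J [eta [phi [phiT ->]]]]; have [kD kM] := compact_hom kC.
rewrite scaler_sumr !(rmod_hom_sum _ _ (compact_hom kC)) scaler_sumr.
by apply: eq_bigr => j _; rewrite /theta -rmulZr !kM rmulZr.
Qed.

Lemma compact_actZ k g c x : @compact M M k ->
  fm_act g (c *: k x) = c *: fm_act g (k x).
Proof.
move=> [J [eta [phi [phiT ->]]]]; rewrite scaler_sumr !fm_act_sum scaler_sumr.
apply: eq_bigr => j _.
by rewrite /theta -rmulZr !fm_act_rmul (is_linZ (gactL _ g)) rmulZr.
Qed.

Lemma compact0 : @compact M M 0.
Proof.
exists void, (fun _ => 0), (fun _ _ => 0); split=> [[]|].
by apply/funext => x; rewrite big_pred0// => -[].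
Qed.

Lemma compactL c k k' :
  @compact M M k -> @compact M M k' -> @compact M M (c *: k + k').
Proof.
move=> [J [eta [phi [phiT ->]]]] [J' [eta' [phi' [phiT' ->]]]].
exists (J + J')%type.
exists (fun j => match j with inl j => c *: eta j | inr j => eta' j end).
exists (fun j => match j with inl j => phi j | inr j => phi' j end).
split=> [[]//|]; apply/funext => x.
rewrite addrfctE scalrfctE big_sumType /= scaler_sumr; congr (_ + _).
by apply: eq_bigr => j _; rewrite /theta rmulZl.
Qed.

Lemma compact_comp k k' :
  @compact M M k -> @compact M M k' -> @compact M M (fun x => k (k' x)).
Proof.
move=> kC [J [eta [phi [phiT ->]]]].
exists J, (fun j => k (eta j)), phi; split=> //; apply/funext => x.
rewrite (rmod_hom_sum _ _ (compact_hom kC)).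
by apply: eq_bigr => j _; rewrite /theta (compact_hom kC).2.
Qed.

(* The action [ad(S)]. *)
Definition ad (g : G) k : M -> M := fun x => fm_act g (k (fm_act g^-1%g x)).

Lemma compact_ad g k : @compact M M k -> @compact M M (ad g k).
Proof.
move=> [J [eta [phi [phiT ->]]]].
exists J, (fun j => fm_act g (eta j)).
exists (fun j x => gact A g (phi j (fm_act g^-1%g x))).
split=> [j|]; first exact: fspace_act.
apply/funext => x; rewrite /ad fm_act_sum.
by apply: eq_bigr => j _; rewrite /theta fm_act_rmul.
Qed.

Definition compact_space : lsubspace (M -> M) := LSubspace compact0 compactL.

Local Notation KM := (lsub_of compact_space).
Implicit Types x y z : KM.

Definition op x : M -> M := lsub_val x.

Lemma op_inj x y : op x =1 op y -> x = y.
Proof. by move=> xy; apply: lsub_inj; apply/funext. Qed.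

Lemma opP x : @compact M M (op x).
Proof. exact: (lsub_in x). Qed.

Lemma opL c x y m : op (c *: x + y) m = c *: op x m + op y m.
Proof. by []. Qed.

Definition mkop k (kC : @compact M M k) : KM := @mklsub _ _ compact_space k kC.

Definition compact_mul x y : KM := mkop (compact_comp (opP x) (opP y)).

Definition compact_act (g : G) x : KM := mkop (compact_ad g (opP x)).

Lemma op_mul x y m : op (compact_mul x y) m = op x (op y m).
Proof. by []. Qed.

Lemma op_act g x m :
  op (compact_act g x) m = fm_act g (op x (fm_act g^-1%g m)).
Proof. by []. Qed.

Lemma compact_mulA x y z :
  compact_mul x (compact_mul y z) = compact_mul (compact_mul x y) z.
Proof. exact: op_inj. Qed.

Lemma compact_mulLl y : is_lin (fun x => compact_mul x y).
Proof. by move=> c u v; exact: op_inj. Qed.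

Lemma compact_mulLr x : is_lin (compact_mul x).
Proof.
move=> c u v; apply: op_inj => m.
by rewrite opL !op_mul opL (compact_hom (opP x)).1 (compactZ _ _ (opP x) (opP u)).
Qed.

Definition compact_alg : algebra := @Algebra KM compact_mul compact_mulA
  (fun x y z => is_linD (compact_mulLl z) x y)
  (fun x y z => is_linD (compact_mulLr x) y z)
  (fun c x y => is_linZ (compact_mulLl y) c x)
  (fun c x y => is_linZ (compact_mulLr x) c y).

Lemma compact_actL g : is_lin (compact_act g : compact_alg -> compact_alg).
Proof.
move=> c u v; apply: op_inj => m.
by rewrite opL !op_act opL fm_actD (compact_actZ _ _ _ (opP u)).
Qed.

Lemma compact_act_mul g (x y : compact_alg) :
  compact_act g (amul x y) =
  amul (compact_act g x : compact_alg) (compact_act g y).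
Proof. by apply: op_inj => m; rewrite !(op_act, op_mul) fm_actKV. Qed.

Lemma compact_act1 x : compact_act 1%g x = x.
Proof. by apply: op_inj => m; rewrite op_act fm_act1 invg1 fm_act1. Qed.

Lemma compact_actM g h x :
  compact_act (g * h)%g x = compact_act g (compact_act h x).
Proof. by apply: op_inj => m; rewrite !op_act invgM !fm_actM. Qed.

(* [(K_A(M), ad(S))] *)
Definition compact_galg : galgebra := @GAlgebra compact_alg
  (GAction compact_actL compact_act_mul compact_act1 compact_actM).

End compact_operators.

Section self_fmodule.

Definition self_fspace (phi : A -> A) := exists a, phi = amul a.

Lemma self_fspace_hom phi :
  self_fspace phi -> @rmod_hom self_rmodule self_rmodule phi.
Proof.
by move=> [a ->]; split=> [x y|x b]; rewrite /= ?amulDr ?amulA.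
Qed.

Lemma self_fspace0 : self_fspace (fun=> 0).
Proof. by exists 0; apply/funext => x; rewrite amul0l. Qed.

Lemma self_fspaceB phi psi : self_fspace phi -> self_fspace psi ->
  self_fspace (fun x => phi x - psi x).
Proof.
move=> [a ->] [b ->]; exists (a - b); apply/funext => x.
by rewrite addrC -scaleN1r -amulLl addrC scaleN1r.
Qed.

Lemma self_fspace_lmul a phi :
  self_fspace phi -> self_fspace (fun x => amul a (phi x)).
Proof. by move=> [b ->]; exists (amul a b); apply/funext => x; rewrite amulA. Qed.

Lemma self_fspace_act g phi : self_fspace phi ->
  self_fspace (fun x => gact A g (phi (gact A g^-1%g x))).
Proof.
move=> [b ->]; exists (gact A g b); apply/funext => x.
by rewrite gact_mul -gactM mulgV gact1.
Qed.

(* The algebra as a functional module over itself. *)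
Definition self_fmodule : fmodule := @FModule self_rmodule (gact A)
  (fun g => is_linD (gactL (gact A) g)) (gact1 (gact A)) (gactM (gact A))
  (fun g x a => gact_mul (gact A) g x a) self_fspace self_fspace_hom
  self_fspace0 self_fspaceB self_fspace_lmul self_fspace_act.

End self_fmodule.

Section direct_sum.
Variables E F : fmodule.
Local Notation EF := (E * F)%type.

Definition dsum_rmul (x : EF) (a : A) : EF := (rmul x.1 a, rmul x.2 a).

Lemma dsum_rmulA x a b : dsum_rmul x (amul a b) = dsum_rmul (dsum_rmul x a) b.
Proof. by rewrite /dsum_rmul !rmulA. Qed.

Lemma dsum_rmulDl x y a : dsum_rmul (x + y) a = dsum_rmul x a + dsum_rmul y a.
Proof. by rewrite /dsum_rmul !rmulDl. Qed.

Lemma dsum_rmulDr x a b : dsum_rmul x (a + b) = dsum_rmul x a + dsum_rmul x b.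
Proof. by rewrite /dsum_rmul !rmulDr. Qed.

Lemma dsum_rmulZl c x a : dsum_rmul (c *: x) a = c *: dsum_rmul x a.
Proof. by rewrite /dsum_rmul !rmulZl. Qed.

Lemma dsum_rmulZr c x a : dsum_rmul x (c *: a) = c *: dsum_rmul x a.
Proof. by rewrite /dsum_rmul !rmulZr. Qed.

Definition dsum_rmodule : rmodule := @RModule EF dsum_rmul
  dsum_rmulA dsum_rmulDl dsum_rmulDr dsum_rmulZl dsum_rmulZr.

Definition dsum_act (g : G) (x : EF) : EF := (fm_act g x.1, fm_act g x.2).

Lemma dsum_actD g x y : dsum_act g (x + y) = dsum_act g x + dsum_act g y.
Proof. by rewrite /dsum_act !fm_actD. Qed.

Lemma dsum_act1 x : dsum_act 1%g x = x.
Proof. by rewrite /dsum_act !fm_act1; case: x. Qed.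

Lemma dsum_actM g h x : dsum_act (g * h)%g x = dsum_act g (dsum_act h x).
Proof. by rewrite /dsum_act !fm_actM. Qed.

Lemma dsum_act_rmul g x a :
  dsum_act g (dsum_rmul x a) = dsum_rmul (dsum_act g x) (gact A g a).
Proof. by rewrite /dsum_act /dsum_rmul !fm_act_rmul. Qed.

Definition dsum_fspace (chi : EF -> A) :=
  exists (phi : E -> A) (psi : F -> A),
    [/\ fspace phi, fspace psi & chi = fun x => phi x.1 + psi x.2].

Lemma dsum_fspace_hom chi :
  dsum_fspace chi -> @rmod_hom dsum_rmodule self_rmodule chi.
Proof.
move=> [phi [psi [/fspace_hom[phiD phiM] /fspace_hom[psiD psiM] ->]]].
split=> [x y|x a] /=; first by rewrite phiD psiD addrACA.
by rewrite phiM psiM /= amulDl.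
Qed.

Lemma dsum_fspace0 : dsum_fspace (fun=> 0).
Proof.
exists (fun=> 0), (fun=> 0); split; try exact: fspace0.
by apply/funext => x; rewrite addr0.
Qed.

Lemma dsum_fspaceB chi chi' : dsum_fspace chi -> dsum_fspace chi' ->
  dsum_fspace (fun x => chi x - chi' x).
Proof.
move=> [phi [psi [phiT psiT ->]]] [phi' [psi' [phiT' psiT' ->]]].
exists (fun x => phi x - phi' x), (fun x => psi x - psi' x).
split; try exact: fspaceB.
by apply/funext => x; rewrite opprD addrACA.
Qed.

Lemma dsum_fspace_lmul a chi :
  dsum_fspace chi -> dsum_fspace (fun x => amul a (chi x)).
Proof.
move=> [phi [psi [phiT psiT ->]]].
exists (fun x => amul a (phi x)), (fun x => amul a (psi x)).
split; try exact: fspace_lmul.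
by apply/funext => x; rewrite amulDr.
Qed.

Lemma dsum_fspace_act g chi : dsum_fspace chi ->
  dsum_fspace (fun x => gact A g (chi (dsum_act g^-1%g x))).
Proof.
move=> [phi [psi [phiT psiT ->]]].
exists (fun x => gact A g (phi (fm_act g^-1%g x))).
exists (fun x => gact A g (psi (fm_act g^-1%g x))).
split; try exact: fspace_act.
by apply/funext => x; rewrite (is_linD (gactL _ g)).
Qed.

Definition dsum : fmodule := @FModule dsum_rmodule dsum_act
  dsum_actD dsum_act1 dsum_actM dsum_act_rmul dsum_fspace dsum_fspace_hom
  dsum_fspace0 dsum_fspaceB dsum_fspace_lmul dsum_fspace_act.

End direct_sum.

(** * The corner embedding [A -> K_A(E (+) A)] *)

Section corner.
Variable E : fmodule.
Local Notation EA := (dsum E self_fmodule).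

Definition corner_op (a : A) (x : EA) : EA := (0, amul a x.2).

Lemma inr_lin : is_lin (fun a : A => ((0, a) : EA)).
Proof.
move=> c u v; rewrite [RHS]surjective_pairing; congr pair => /=.
by rewrite scaler0 addr0.
Qed.

Hypothesis Aq : quadratik A.

Lemma compact_corner_op a : @compact EA EA (corner_op a).
Proof.
have [J [x [y ->]]] := Aq a.
exists J, (fun j => (0, x j)), (fun j (z : EA) => amul (y j) z.2); split.
  move=> j; exists (fun=> 0), (amul (y j)).
  split; [exact: fspace0|by exists (y j)|].
  by apply/funext => z; rewrite add0r.
apply/funext => z; rewrite /corner_op amul_suml.
rewrite (is_lin_sum inr_lin); apply: eq_bigr => j _; rewrite /theta /=.
by rewrite /dsum_rmul /= (is_lin0 (rmulLl _)) amulA.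
Qed.

Definition corner_fun (a : A) : compact_galg EA := mkop (compact_corner_op a).

Lemma op_corner a (x : EA) : op (corner_fun a) x = (0, amul a x.2).
Proof. by []. Qed.

Lemma corner_funL : is_lin corner_fun.
Proof.
move=> c u v; apply: op_inj => x; rewrite opL !op_corner amulLl.
exact: inr_lin.
Qed.

Lemma corner_fun_mul a b :
  corner_fun (amul a b) = amul (corner_fun a) (corner_fun b).
Proof.
apply: op_inj => x; rewrite op_mul !op_corner /=.
by rewrite amulA.
Qed.

Lemma corner_fun_act g a :
  corner_fun (gact A g a) = gact (compact_galg EA) g (corner_fun a).
Proof.
apply: op_inj => x; rewrite op_act !op_corner /= /dsum_act /=.
rewrite gact_mul -gactM mulgV gact1; congr pair.
by apply: (addrI (fm_act g (0 : E))); rewrite -fm_actD !addr0.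
Qed.

Definition corner : ghom A (compact_galg EA) :=
  @GHom A (compact_galg EA) corner_fun corner_funL corner_fun_mul
    corner_fun_act.

End corner.

(** * The functional module [A^n = C^n (x) A] *)

Section coordinate_module.
Variable I : choiceType.

(* A [G]-action on [C^n] by linear maps. *)
Record free_action := FreeAction {
  fract :> G -> free C I -> free C I;
  fractL : forall g, is_lin (fract g);
  fract1 : forall v, fract 1%g v = v;
  fractM : forall g h v, fract (g * h)%g v = fract g (fract h v) }.

Variable delta : free_action.
Local Notation An := (fam I A).

Lemma coord_rmul_supp (x : An) (a : A) :
  finitely_supported (fun i => amul (coef x i) a).
Proof.
have [D xD] := fam_supp x; apply/finitely_supportedP; exists D => i /xD ->.
exact: amul0l.
Qed.

Definition coord_rmul (x : An) (a : A) : An := mkfam (coord_rmul_supp x a).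

Lemma coef_rmul x a i : coef (coord_rmul x a) i = amul (coef x i) a.
Proof. by []. Qed.

Lemma coord_rmulA x a b :
  coord_rmul x (amul a b) = coord_rmul (coord_rmul x a) b.
Proof. by apply: fam_inj => i; rewrite !coef_rmul amulA. Qed.

Lemma coord_rmulLl a : is_lin (fun x => coord_rmul x a).
Proof.
by move=> c u v; apply: fam_inj => i; rewrite !(coef_rmul, coefD, coefZ) amulLl.
Qed.

Lemma coord_rmulLr x : is_lin (coord_rmul x).
Proof.
by move=> c u v; apply: fam_inj => i; rewrite !(coef_rmul, coefD, coefZ) amulLr.
Qed.

Definition coord_rmodule : rmodule := @RModule An coord_rmul coord_rmulA
  (fun x y a => is_linD (coord_rmulLl a) x y)
  (fun x a b => is_linD (coord_rmulLr x) a b)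
  (fun c x a => is_linZ (coord_rmulLl a) c x)
  (fun c x a => is_linZ (coord_rmulLr x) c a).

(* [delta (x) alpha] *)
Definition coord_act (g : G) : An -> An := tens (delta g) (gact A g).

Lemma coord_actL g : is_lin (coord_act g).
Proof. exact/tens_lin/gactL. Qed.

Lemma coord_actD g (x y : An) :
  coord_act g (x + y) = coord_act g x + coord_act g y.
Proof. exact: is_linD (coord_actL g) _ _. Qed.

Lemma coord_act1 x : coord_act 1%g x = x.
Proof. by apply: tens_id => ?; rewrite ?fract1 ?gact1. Qed.

Lemma coord_actM g h x : coord_act (g * h)%g x = coord_act g (coord_act h x).
Proof.
have dl := fractL delta; have al := gactL (gact A).
rewrite /coord_act tens_comp//.
by apply: eq_tens => ?; rewrite ?fractM ?gactM.
Qed.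

Lemma coord_act_rmul g x a :
  coord_act g (coord_rmul x a) = coord_rmul (coord_act g x) (gact A g a).
Proof.
have [D xD] := fam_supp x; have a0 := is_lin0 (gactL (gact A) g).
rewrite /coord_act !(@tensE _ _ _ _ _ _ D)//; last first.
  by move=> i iD; rewrite coef_rmul xD// amul0l.
rewrite (is_lin_sum (coord_rmulLl (gact A g a))); apply: eq_bigr => i _.
apply: fam_inj => j.
by rewrite !(coef_rmul, coef_elt) gact_mul amulZl.
Qed.

(* The functionals [xi |-> sum_i x_i xi_i] with [x] in [A^n]. *)
Definition coord_fspace (phi : An -> A) := exists x : An,
  phi = fun xi => \sum_(i \in [set: I]) amul (coef x i) (coef xi i).

Lemma coord_fspaceE (x xi : An) (D : {fset I}) :
  (forall i, i \notin D -> coef x i = 0) ->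
  \sum_(i \in [set: I]) amul (coef x i) (coef xi i) =
  \sum_(i <- D) amul (coef x i) (coef xi i).
Proof. by move=> xD; apply: fsbigTE => i /xD ->; rewrite amul0l. Qed.

Lemma coord_fspace_hom phi :
  coord_fspace phi -> @rmod_hom coord_rmodule self_rmodule phi.
Proof.
move=> [x ->]; have [D xD] := fam_supp x.
split=> [u v|u a]; rewrite !(coord_fspaceE _ xD).
  rewrite -big_split; apply: eq_bigr => i _ /=.
  by rewrite coefD amulDr.
rewrite [RHS]amul_suml; apply: eq_bigr => i _.
by rewrite coef_rmul amulA.
Qed.

Lemma coord_fspace0 : coord_fspace (fun=> 0).
Proof.
exists 0; apply/funext => xi; rewrite fsbig1// => i _.
by rewrite coef0 amul0l.
Qed.

Lemma coord_fspaceB phi psi : coord_fspace phi -> coord_fspace psi ->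
  coord_fspace (fun x => phi x - psi x).
Proof.
move=> [x ->] [y ->]; exists (-1 *: y + x); apply/funext => xi.
have [D xD] := fam_supp x; have [E yE] := fam_supp y.
have xDE i : i \notin (D `|` E)%fset -> coef x i = 0.
  by rewrite in_fsetU negb_or => /andP[/xD].
have yDE i : i \notin (D `|` E)%fset -> coef y i = 0.
  by rewrite in_fsetU negb_or => /andP[_ /yE].
rewrite (coord_fspaceE _ xDE) (coord_fspaceE _ yDE).
rewrite (@coord_fspaceE _ _ (D `|` E)%fset); last first.
  by move=> i iDE; rewrite coefD coefZ xDE// yDE// scaler0 addr0.
rewrite addrC -scaleN1r scaler_sumr -big_split; apply: eq_bigr => i _ /=.
by rewrite coefD coefZ amulLl.
Qed.

Lemma coord_fspace_lmul a phi :
  coord_fspace phi -> coord_fspace (fun x => amul a (phi x)).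
Proof.
move=> [x ->]; have [D xD] := fam_supp x.
have yf : finitely_supported (fun i => amul a (coef x i)).
  by apply/finitely_supportedP; exists D => i /xD ->; rewrite amul0r.
exists (mkfam yf); apply/funext => xi.
rewrite (coord_fspaceE _ xD) (@coord_fspaceE _ _ D); last first.
  by move=> i iD; rewrite /coef/= -/(coef x i) xD// amul0r.
by rewrite amul_sumr; apply: eq_bigr => i _; rewrite amulA.
Qed.

(* [delta (x) alpha] makes [A^n] a functional module. *)
Definition coord_invariant := forall g phi, coord_fspace phi ->
  coord_fspace (fun x => gact A g (phi (coord_act g^-1%g x))).

Definition coord_fmodule (inv : coord_invariant) : fmodule :=
  @FModule coord_rmodule coord_act coord_actD coord_act1 coord_actM
    coord_act_rmul coord_fspace coord_fspace_hom coord_fspace0 coord_fspaceB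
    coord_fspace_lmul inv.

End coordinate_module.

(** * Functional extensions *)

Section extensions.
Variables E F : fmodule.

(* [Us] is only meaningful on [Theta_A(E)]. *)
Record fmod_hom (U : E -> F) (Us : (E -> A) -> F -> A) : Prop := FModHom {
  fmh_hom : rmod_hom U;
  fmh_act : forall g x, U (fm_act g x) = fm_act g (U x);
  fmh_star : forall phi, fspace phi -> fspace (Us phi);
  fmh_starD : forall phi psi, fspace phi -> fspace psi ->
    Us (fun x => phi x + psi x) = fun y => Us phi y + Us psi y;
  fmh_starM : forall a phi, fspace phi ->
    Us (fun x => amul a (phi x)) = fun y => amul a (Us phi y);
  fmh_star_act : forall g phi, fspace phi ->
    Us (fun x => gact A g (phi (fm_act g^-1%g x))) =
    fun y => gact A g (Us phi (fm_act g^-1%g y));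
  fmh_pair : forall phi x, fspace phi -> Us phi (U x) = phi x }.

Definition functional_extension (U : E -> F) (Us : (E -> A) -> F -> A) :=
  [/\ fmod_hom U Us, injective U &
    forall (J : finType) (phi : J -> E -> A) (y : F),
      (forall j, fspace (phi j)) ->
      exists x : E, forall j, Us (phi j) y = phi j x].

End extensions.

End modules.

(** * The category [Lambda] *)

(* [ob] is the class of objects; [mor] turns algebra homomorphisms into
   morphisms. Cardinalities are represented by index types. The algebra [K_A(M)]
   need not be quadratik for an arbitrary [M]. *)
Record algebra_category := AlgebraCategory {
  ob : galgebra -> Prop;
  ob_quadratik : forall A, ob A -> quadratik A;
  admissible : choiceType -> Prop;
  ob_mat : forall (A : galgebra) (I : choiceType)
    (gamma : gaction (mat_alg I complex_alg)),
    ob A -> admissible I -> ob (mat_galg A gamma);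
  ob_compact : forall (A : galgebra) (M : fmodule A),
    ob A -> quadratik (compact_galg M) -> ob (compact_galg M);
  ob_path : forall A, ob A -> ob (path_galg A);
  hom : {A | ob A} -> {A | ob A} -> Type;
  idm : forall A, hom A A;
  comp : forall A B D, hom B D -> hom A B -> hom A D;
  comp_idl : forall A B (f : hom A B), comp (idm B) f = f;
  comp_idr : forall A B (f : hom A B), comp f (idm A) = f;
  compA : forall A B D E (f : hom D E) (g : hom B D) (h : hom A B),
    comp f (comp g h) = comp (comp f g) h;
  mor : forall A B : {A | ob A}, ghom (sval A) (sval B) -> hom A B;
  mor_id : forall A : {A | ob A}, mor (ghom_id (sval A)) = idm A;
  mor_comp : forall (A B D : {A | ob A})
    (f : ghom (sval B) (sval D)) (h : ghom (sval A) (sval B)),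
    mor (ghom_comp f h) = comp (mor f) (mor h) }.

Definition invertible (L : algebra_category) (A B : {A | ob L A})
    (f : hom A B) :=
  exists h : hom B A, comp h f = idm A /\ comp f h = idm B.

Definition object (L : algebra_category) (A : galgebra) (obA : ob L A) :
  {A | ob L A} := exist _ A obA.

(* All cardinalities, or those up to some cardinality [X], inclusively or
   strictly; the strict version allows for the finite cardinalities only. *)
Definition cardinality_range (P : choiceType -> Prop) :=
  [\/ forall I, P I,
      exists X : choiceType, forall I : choiceType,
        P I <-> ([set: I] #<= [set: X])%card |
      exists X : choiceType, forall I : choiceType,
        P I <-> ~ ([set: X] #<= [set: I])%card].

Record lambda_category := LambdaCategory {
  lam_cat :> algebra_category;
  lam_range : cardinality_range (admissible lam_cat);
  lam_finite : forall n, admissible lam_cat 'I_n;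
  (* The corner embeddings [A -> M_n (x) A] are invertible. *)
  lam_corner : forall (A : galgebra) (I : choiceType) (j : I)
    (gamma : gaction (mat_alg I complex_alg))
    (obA : ob lam_cat A) (adI : admissible lam_cat I)
    (e : ghom A (mat_galg A gamma)),
    (forall a, e a = elt (basis C (j, j)) a) ->
    invertible (@mor lam_cat (object obA) (object (ob_mat gamma obA adI)) e);
  lam_homotopy : forall (A B : galgebra) (obA : ob lam_cat A)
    (obB : ob lam_cat B) (f : ghom A (path_galg B)),
    @mor lam_cat (object obA) (object obB) (ghom_comp (ghom_eval B ui0) f) =
    @mor lam_cat (object obA) (object obB) (ghom_comp (ghom_eval B ui1) f) }.

End algebras.

(* Main.v *)
Require Import Defs.
From HB Require Import structures.
From mathcomp Require Import all_boot all_order all_algebra.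
From mathcomp Require Import finmap complex ring.
From mathcomp Require Import all_classical all_reals all_analysis.
Import Defs.

Set Implicit Arguments.
Unset Strict Implicit.
Unset Printing Implicit Defensive.

Import Order.TTheory GRing.Theory Num.Theory.

Local Open Scope classical_set_scope.
Local Open Scope ring_scope.

(** Write [P] for [E (+) B] and [K] for [K_B(P)], let [e : B -> K] be the corner
    embedding, and let [D_g] be [delta_g (+) 1] on the free module over
    [option I], the new coordinate being [None]. A functional extension makes
    [sum_r theta_(eta_r, phi_r) |-> sum_r theta_(V eta_r, V^* phi_r)]
    independent of the presentation of an operator: given finitely many functionals
    [phi_r] and a vector [y], a single [x] satisfies [V^* phi_r (y) = phi_r x]
    for all [r], so the value at [y] is [V (k x)]. Applied to [V (+) 1] this
    gives [f : K -> M_n+1(B)], and [f o e] is the corner embedding of [B] at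
    [None], which is invertible. So [e] has a left inverse.

    For the right inverse, the two homomorphisms [M_n+1(e) o f] and
    [kappa : k |-> e_(None,None) (x) k] from [K] to [M_n+1(K)] are joined by
    a path. Both have the form [theta_(eta, phi) |-> theta_(W eta, W^* phi)],
    for maps of [P] into [C^(n+1) (x) P]: the second uses the coordinate [None],
    the first sends [xi + b] to [V xi] in the [B]-parts of the coordinates of
    [I] plus [b] in the [B]-part of [None]. They agree on [B], and on [E] they
    have orthogonal images, so one may rotate from one to the other: with
    [W_t = (1 - t^2) W_source + t W_target + W_fixed] and
    [W_t^* = (1 - t^2) W_source^* + t (2 - t^2) W_target^* + W_fixed^*] the
    identity [(1 - t^2)^2 + t^2 (2 - t^2) = 1] says that the pairing of
    functionals with vectors is preserved, hence that every [t] gives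
    a homomorphism. Polynomial weights serve as well as cosine and sine because
    vectors and functionals may be weighted differently.

    Homotopy invariance gives [M(e) f = kappa] in [Lambda]; with
    [M(e) o (f o e) = kappa o e] and the invertibility of [f o e] and [kappa],
    this makes [e] invertible ([invertible_of_factorization]). The map [f] is
    obtained from the endpoint [t = 1] of the path, whose matrix entries lie in
    the image of the injective map [e] ([ghom_factor]).

    Two points need care. The size [n + 1] has to be admissible
    ([admissible_option]), and conjugation by [D_g] has to preserve finitely
    supported matrices, i.e. the rows of [delta_g] must be finite. The latter
    follows from the invariance of the functional space of [B^n] when [B <> 0]
    ([coord_invariant_row_finite]); when [B = 0], also [K = 0]. *)

(** * Admissibility of n + 1 *)

Lemma inj_card_leT (T U : Type) (f : T -> U) :
  injective f -> ([set: T] #<= [set: U])%card.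
Proof.
move=> finj; have /card_eqPle[_ le] := inj_card_eq (A := [set: T]) (in2W finj).
exact: card_le_trans le (subset_card_le (@subsetT _ _)).
Qed.

Lemma infinite_option_le (T : Type) :
  infinite_set [set: T] -> ([set: option T] #<= [set: T])%card.
Proof.
move=> /infiniteP; elim/Ppointed: T => T.
  by rewrite emptyE => /eqP nat0; case: infinite_nat; rewrite nat0.
move=> /pcard_injP[f finj].
have {}finj m n : f m = f n -> m = n by apply: finj; rewrite in_setT.
(* Hilbert's hotel: the new point goes to f 0, and f n moves to f n.+1. *)
pose shift (x : option T) := if x is Some y then
    if pselect (exists n, y = f n) is left ex then f (projT1 (cid ex)).+1 else y
  else f 0%N.
apply: (@inj_card_leT _ _ shift) => -[x|] [y|]; rewrite /shift => //.
- case: pselect => [exx|nx]; case: pselect => [exy|ny].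
  + by case: cid => m /= ->; case: cid => n /= -> /finj[->].
  + by move=> yE; case: ny; exists (projT1 (cid exx)).+1.
  + by move=> xE; case: nx; exists (projT1 (cid exy)).+1.
  + by move=> ->.
- case: pselect => [exx /finj //|nx xE]; by case: nx; exists 0%N.
- case: pselect => [exy /finj //|ny yE]; by case: ny; exists 0%N.
Qed.

Lemma cardinality_range_le (P : choiceType -> Prop) (I J : choiceType) :
  cardinality_range P -> ([set: J] #<= [set: I])%card -> P I -> P J.
Proof.
move=> [PT|[X PX]|[X PX]] JI; first by move=> _; exact: PT.
  by rewrite !PX; exact: card_le_trans.
by rewrite !PX; apply: contra_not => /card_le_trans; apply.
Qed.

(** An infinite set absorbs one more point; a finite one stays finite, and all
    finite cardinalities are admissible. *)
Lemma admissible_option (R : realType) (G : groupType) (L : lambda_category R G)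
    (I : choiceType) : admissible L I -> admissible L (option I).
Proof.
move=> adI; have [fin|inf] := pselect (finite_set [set: option I]).
  have [n /card_eqPle[le _]] := fin.
  apply: cardinality_range_le (lam_range L) _ (lam_finite L n).
  by apply: card_le_trans le _; have /card_eqPle[] := @card_II n.
apply: cardinality_range_le (lam_range L) _ adI.
apply: infinite_option_le; apply: contra_not inf => fin.
suff -> : [set: option I] = None |` [set Some x | x in [set: I]].
  by rewrite finite_setU; split; [exact: finite_set1|exact: finite_image].
apply/seteqP; split=> // -[x|] _; [by right; exists x|by left].
Qed.

(** * Sums over finite sets of indices *)

Section fset_sums.
Variables (V : zmodType) (J : choiceType).

Lemma big_fsetM (D E : {fset J}) (F : J -> J -> V) :
  \sum_(p <- (D `*` E)%fset) F p.1 p.2 = \sum_(j <- D) \sum_(k <- E) F j k.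
Proof.
transitivity (\sum_(p <- [seq (j, k) | j <- D, k <- E]) F p.1 p.2);
  last by rewrite big_allpairs.
apply/perm_big/uniq_perm; first exact: fset_uniq.
  by apply: allpairs_uniq => // -[? ?] [].
move=> -[j k]; rewrite in_fsetM; apply/idP/allpairsP => [/andP[jD kE]|].
  by exists (j, k).
by move=> [[j' k'] /= [jD kE [-> ->]]]; rewrite jD.
Qed.

Lemma fsbig_option (A : {fset J}) (F : option J -> V) :
  (forall j, j \notin A -> F (Some j) = 0) ->
  \sum_(j \in [set: option J]) F j = F None + \sum_(j <- A) F (Some j).
Proof.
move=> FA; pose SA := [fset Some j | j in A]%fset.
have NSA : None \notin SA by apply/negP => /imfsetP[].
rewrite (fsbigTE (None |` SA)%fset) => [|[j|]]; last by rewrite fset1U1.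
  rewrite big_fsetU1//= big_imfset//= => x y _ _; exact: Some_inj.
rewrite !inE /= => jA; apply: FA; apply: contraNN jA => jA.
by apply/imfsetP; exists j.
Qed.

Lemma common_fset (T : finType) (P : T -> J -> Prop) :
  (forall t, exists D : {fset J}, forall j, j \notin D -> P t j) ->
  exists D : {fset J}, forall t j, j \notin D -> P t j.
Proof.
move=> /choice[D DP]; exists (\bigcup_(t <- enum T) D t)%fset => t j jD.
apply: DP; apply: contraNN jD => jD; apply/bigfcupP.
by exists t; rewrite // mem_enum.
Qed.

End fset_sums.

(** * Conjugation of matrices by a group action *)

Section linear_extension.
Variables (K : comNzRingType) (J : choiceType) (V : lmodType K).

Definition lin_ext (h : J -> V) (x : free K J) : V :=
  \sum_(j \in [set: J]) (coef x j : K) *: h j.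

Lemma lin_extE h (x : free K J) (D : {fset J}) :
  (forall j, j \notin D -> coef x j = 0) ->
  lin_ext h x = \sum_(j <- D) (coef x j : K) *: h j.
Proof. by move=> xD; apply: fsbigTE => j /xD ->; rewrite scale0r. Qed.

Lemma lin_ext_lin h : is_lin (lin_ext h).
Proof.
move=> c x y; have [D xD] := fam_supp x; have [E yE] := fam_supp y.
have xDE j : j \notin (D `|` E)%fset -> coef x j = 0.
  by rewrite in_fsetU negb_or => /andP[/xD].
have yDE j : j \notin (D `|` E)%fset -> coef y j = 0.
  by rewrite in_fsetU negb_or => /andP[_ /yE].
rewrite (lin_extE _ xDE) (lin_extE _ yDE) (@lin_extE _ _ (D `|` E)%fset).
  rewrite scaler_sumr -big_split; apply: eq_bigr => j _ /=.
  by rewrite coefD coefZ scalerDl scalerA.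
by move=> j jDE; rewrite coefD coefZ xDE// yDE// scaler0 addr0.
Qed.

Lemma lin_ext_basis h j : lin_ext h (basis K j) = h j.
Proof.
rewrite (@lin_extE _ _ [fset j]%fset) ?big_seq_fset1 ?coef_basis ?eqxx ?scale1r//.
by move=> k; rewrite in_fset1 coef_basis => /negPf ->.
Qed.

Lemma basis_decomp (x : free K J) (D : {fset J}) :
  (forall j, j \notin D -> coef x j = 0) ->
  x = \sum_(j <- D) (coef x j : K) *: basis K j.
Proof.
move=> xD; rewrite [LHS](fam_decomp xD); apply: eq_bigr => j _.
by apply: fam_inj => k; rewrite coef_elt coefZ /= /GRing.scale /= mulrC.
Qed.

Lemma eq_on_basis (f h : free K J -> V) :
  is_lin f -> is_lin h -> (forall j, f (basis K j) = h (basis K j)) -> f =1 h.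
Proof.
move=> fl hl fh x; have [D xD] := fam_supp x.
rewrite (basis_decomp xD) (is_lin_sum fl) (is_lin_sum hl).
by apply: eq_bigr => j _; rewrite (is_linZ fl) (is_linZ hl) fh.
Qed.

End linear_extension.

Section matrix_actions.
Variables (R : realType) (G : groupType).
Local Notation C := R[i].

(** Finite columns make [mact g] an operator on finitely supported vectors;
    finite rows let it act on finitely supported row vectors, too, so that
    conjugation preserves the matrices with finitely many nonzero entries. *)
Record matrix_action (I : choiceType) := MatrixAction {
  mact :> G -> I -> I -> C;
  mact_col : forall g j, exists D : {fset I},
    forall i, i \notin D -> mact g i j = 0;
  mact_row : forall g i, exists D : {fset I},
    forall j, j \notin D -> mact g i j = 0;
  mact1 : forall i j, mact 1%g i j = (i == j)%:R;
  mactM : forall g h i k,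
    mact (g * h)%g i k = \sum_(j \in [set: I]) mact g i j * mact h j k }.

Section conjugation.
Variables (I : choiceType) (d : matrix_action I).
Local Notation mat := (mat_alg I (complex_alg R)).

Lemma mactME g h i k (D : {fset I}) :
  (forall j, j \notin D -> d g i j = 0 \/ d h j k = 0) ->
  d (g * h)%g i k = \sum_(j <- D) d g i j * d h j k.
Proof.
by move=> dD; rewrite mactM; apply: fsbigTE => j /dD[] ->; rewrite ?mul0r ?mulr0.
Qed.

(** The conjugate of the matrix unit [e_(j,k)] is column [j] of [d g] times row
    [k] of its inverse. *)
Lemma conj_unit_supp g (p : I * I) :
  @finitely_supported C (I * I)%type C^o
    (fun q => d g q.1 p.1 * d g^-1%g p.2 q.2).
Proof.
have [D dD] := mact_col d g p.1; have [E dE] := mact_row d g^-1%g p.2.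
apply/finitely_supportedP; exists (D `*` E)%fset => -[i l].
rewrite in_fsetM /= negb_and => /orP[/dD ->|/dE ->]; first by rewrite mul0r.
by rewrite mulr0.
Qed.

Definition conj_unit g (p : I * I) : free C (I * I)%type :=
  mkfam (conj_unit_supp g p).

Lemma coef_conj_unit g p i l :
  coef (conj_unit g p) (i, l) = d g i p.1 * d g^-1%g p.2 l.
Proof. by []. Qed.

Definition conj_mat g : mat -> mat := lin_ext (conj_unit g).

Lemma conj_mat_lin g : is_lin (conj_mat g).
Proof. exact: lin_ext_lin. Qed.

Lemma mat_mul_basis (j k l m : I) :
  amul (basis C (j, k) : mat) (basis C (l, m)) = (k == l)%:R *: basis C (j, m).
Proof.
apply: fam_inj => -[a b].
rewrite (@mat_mulE R I (complex_alg R) _ _ [fset k]%fset); last first.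
  move=> c; rewrite in_fset1 => /negPf ck; left.
  by rewrite coef_basis xpair_eqE ck andbF.
rewrite big_seq_fset1 coefZ !coef_basis !xpair_eqE eqxx andbT /=.
rewrite /GRing.scale /=; case: (a == j) (k == l) (b == m) => [] [] [];
  by rewrite ?(mul0r, mulr0, mul1r, mulr1).
Qed.

Lemma conj_unit_mul g (p q : I * I) :
  amul (conj_unit g p : mat) (conj_unit g q) =
  conj_mat g (amul (basis C p : mat) (basis C q)).
Proof.
case: p q => [j k] [l m]; rewrite mat_mul_basis (is_linZ (conj_mat_lin g)).
rewrite /conj_mat lin_ext_basis; apply: fam_inj => -[a b].
have [D dD] := mact_row d g^-1%g k.
rewrite (@mat_mulE R I (complex_alg R) _ _ D); last first.
  by move=> c /dD cD; left; rewrite coef_conj_unit /= cD mulr0.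
rewrite coefZ coef_conj_unit /= -(mact1 d) -(mulVg g) (@mactME _ _ _ _ D).
  rewrite /GRing.scale /= mulr_suml; apply: eq_bigr => c _.
  by rewrite !coef_conj_unit /=; ring.
by move=> c /dD ->; left.
Qed.

Lemma conj_mat_mul g (x y : mat) :
  conj_mat g (amul x y) = amul (conj_mat g x) (conj_mat g y).
Proof.
have [D xD] := fam_supp x; have [E yE] := fam_supp y.
rewrite (basis_decomp xD) (basis_decomp yE).
have key := @is_lin_mul_sum R mat (conj_mat g) _ _ (enum_fset D) (enum_fset E)
  (fun p => coef x p *: basis C p) (fun p => coef y p *: basis C p)
  (conj_mat_lin g).
apply: key => p q.
rewrite amulZl amulZr !(is_linZ (conj_mat_lin g)) amulZl amulZr.
by rewrite -conj_unit_mul /conj_mat !lin_ext_basis.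
Qed.

Lemma conj_mat1 (x : mat) : conj_mat 1%g x = x.
Proof.
apply: (eq_on_basis (conj_mat_lin 1%g)) => // -[j k].
rewrite /conj_mat lin_ext_basis; apply: fam_inj => -[i l].
rewrite coef_conj_unit coef_basis invg1 !mact1 -natrM mulnb.
by rewrite xpair_eqE (eq_sym k).
Qed.

Lemma coef_conj_mat g (x : mat) (D : {fset I}) i l :
  (forall j k, (j \notin D) || (k \notin D) -> coef x (j, k) = 0) ->
  coef (conj_mat g x) (i, l) =
  \sum_(j <- D) \sum_(k <- D) (d g i j * d g^-1%g k l) *: coef x (j, k).
Proof.
move=> xD; rewrite /conj_mat (@lin_extE _ _ _ _ _ (D `*` D)%fset); last first.
  by move=> [j k]; rewrite in_fsetM negb_and => /xD.
rewrite coef_sum -(big_fsetM _ _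
  (fun j k => (d g i j * d g^-1%g k l) *: coef x (j, k))).
refine (@eq_bigr _ _ _ _ _ _ _ _ _) => -[j k] _; rewrite coefZ coef_conj_unit.
by rewrite /GRing.scale /= mulrC.
Qed.

Lemma conj_matM g h (x : mat) : conj_mat (g * h)%g x = conj_mat g (conj_mat h x).
Proof.
have lin_gh : is_lin (conj_mat g \o conj_mat h).
  by move=> c u v; rewrite /= !conj_mat_lin.
apply: (eq_on_basis (conj_mat_lin (g * h)%g) lin_gh) => -[j k].
rewrite /conj_mat /= !lin_ext_basis -/(conj_mat g _).
apply: fam_inj => -[i l].
have [E1 dE1] := mact_col d h j; have [E2 dE2] := mact_row d h^-1%g k.
have hE1 a : a \notin (E1 `|` E2)%fset -> d h a j = 0.
  by rewrite in_fsetU negb_or => /andP[/dE1].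
have hE2 a : a \notin (E1 `|` E2)%fset -> d h^-1%g k a = 0.
  by rewrite in_fsetU negb_or => /andP[_ /dE2].
rewrite (@coef_conj_mat _ _ (E1 `|` E2)%fset); last first.
  move=> a b /orP[/hE1 a0|/hE2 b0]; rewrite coef_conj_unit /= ?a0 ?b0.
    by rewrite mul0r.
  by rewrite mulr0.
rewrite coef_conj_unit /= invgM.
rewrite (@mactME _ _ _ _ (E1 `|` E2)%fset); last by move=> a /hE1; right.
rewrite (@mactME _ _ _ _ (E1 `|` E2)%fset); last by move=> a /hE2; left.
rewrite mulr_suml; apply: eq_bigr => a _; rewrite mulr_sumr.
by apply: eq_bigr => b _; rewrite coef_conj_unit /GRing.scale /=; ring.
Qed.

Definition conj_action : gaction G mat :=
  GAction conj_mat_lin conj_mat_mul conj_mat1 conj_matM.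

Lemma coef_conj_act (A : galgebra R G) g (X : mat_galg A conj_action)
    (D : {fset I}) i l :
  (forall j k, (j \notin D) || (k \notin D) -> coef X (j, k) = 0) ->
  coef (gact (mat_galg A conj_action) g X) (i, l) =
  \sum_(j <- D) \sum_(k <- D)
    (d g i j * d g^-1%g k l) *: gact A g (coef X (j, k)).
Proof.
move=> XD; rewrite /= /mat_act (@tensE _ _ _ _ _ _ (D `*` D)%fset).
- rewrite coef_sum -(big_fsetM _ _
    (fun j k => (d g i j * d g^-1%g k l) *: gact A g (coef X (j, k)))).
  apply: eq_bigr => -[j k] _; rewrite coef_elt /=.
  by rewrite /conj_mat lin_ext_basis coef_conj_unit.
- exact: is_lin0 (gactL _ g).
- by move=> [j k]; rewrite in_fsetM negb_and => /XD.
Qed.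

End conjugation.
End matrix_actions.

Section matrix_action_constructions.
Variables (R : realType) (G : groupType) (I : choiceType).
Local Notation C := R[i].

(** The direct sum with the trivial action on one further coordinate. *)
Definition option_mat (d : matrix_action R G I) (g : G) (i j : option I) : C :=
  match i, j with
  | Some i, Some j => d g i j
  | None, None => 1
  | _, _ => 0
  end.

Section option_action.
Variable d : matrix_action R G I.

Lemma some_fset (P : option I -> Prop) (D : {fset I}) :
  (forall i, i \notin D -> P (Some i)) ->
  exists E : {fset option I}, forall i, i \notin E -> P i.
Proof.
move=> DP; exists (None |` [fset Some i | i in D])%fset => -[i|].
  rewrite !inE /= => iD; apply: DP; apply: contraNN iD => iD.
  by apply/imfsetP; exists i.
by rewrite fset1U1.
Qed.

Lemma option_mat_col g j : exists D : {fset option I},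
  forall i, i \notin D -> option_mat d g i j = 0.
Proof.
case: j => [j|]; last by apply: (@some_fset _ fset0) => i.
by have [D dD] := mact_col d g j; exact: some_fset dD.
Qed.

Lemma option_mat_row g i : exists D : {fset option I},
  forall j, j \notin D -> option_mat d g i j = 0.
Proof.
case: i => [i|]; last by apply: (@some_fset _ fset0) => i.
by have [D dD] := mact_row d g i; exact: some_fset dD.
Qed.

Lemma option_mat1 i j : option_mat d 1%g i j = (i == j)%:R.
Proof. by case: i j => [i|] [j|] //=; rewrite mact1. Qed.

Lemma option_matM g h i k : option_mat d (g * h)%g i k =
  \sum_(j \in [set: option I]) option_mat d g i j * option_mat d h j k.
Proof.
have [D dD] : exists D : {fset I}, forall j, j \notin D ->
    option_mat d g i (Some j) = 0.
  case: i => [i|]; last by exists fset0.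
  exact: mact_row d g i.
rewrite (fsbig_option (A := D)) => [|j /dD ->]; last by rewrite mul0r.
case: i k dD => [i|] [k|] /= dD; rewrite ?(mul0r, mulr0, mulr1, add0r).
- by apply: mactME => j /dD; left.
- by rewrite big1// => j _; rewrite mulr0.
- by rewrite big1// => j _; rewrite mul0r.
- by rewrite big1 ?addr0// => j _; rewrite mul0r.
Qed.

Definition option_action : matrix_action R G (option I) :=
  MatrixAction option_mat_col option_mat_row option_mat1 option_matM.

End option_action.

Section free_actions.
Variable delta : free_action R G I.

Definition row_finite := forall g i, exists D : {fset I},
  forall j, j \notin D -> coef (delta g (basis C j)) i = 0.

Section row_finite_action.
Hypothesis delta_row : row_finite.

Let mat_of g i j : C := coef (delta g (basis C j)) i.

Let mat_of_col g j : exists D : {fset I},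
  forall i, i \notin D -> mat_of g i j = 0.
Proof. exact: fam_supp. Qed.

Let mat_of1 i j : mat_of 1%g i j = (i == j)%:R.
Proof. by rewrite /mat_of fract1 coef_basis. Qed.

Let mat_ofM g h i k :
  mat_of (g * h)%g i k = \sum_(j \in [set: I]) mat_of g i j * mat_of h j k.
Proof.
rewrite /mat_of fractM; have [D hD] := fam_supp (delta h (basis C k)).
rewrite (basis_decomp hD) (is_lin_sum (fractL delta g)) coef_sum.
rewrite -(basis_decomp hD) (fsbigTE D) => [|j /hD ->]; last by rewrite mulr0.
apply: eq_bigr => j _; rewrite (is_linZ (fractL delta g)) coefZ.
by rewrite /GRing.scale /= mulrC.
Qed.

Definition free_matrix_action : matrix_action R G I :=
  MatrixAction mat_of_col delta_row mat_of1 mat_ofM.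

End row_finite_action.

(** Apply [g^-1] to the functional [xi |-> b xi_i] and evaluate it at [e_j (x) c]:
    the result is the [(i, j)] entry of [delta g] times [(g^-1 b) c], and it
    vanishes for almost all [j] since the functional is given by a finitely
    supported family. Left faithfulness provides [c] with [(g^-1 b) c <> 0]. *)
Lemma coord_invariant_row_finite (A : galgebra R G) (b : A) :
  left_faithful A -> b != 0 -> coord_invariant A delta -> row_finite.
Proof.
move=> Af b0 inv g i.
have bgc : exists c, amul (gact A g^-1%g b) c != 0.
  apply: contrapT => /forallNP nc; case/eqP: b0.
  rewrite -[b](gact1 (gact A)) -(mulgV g) gactM.
  suff -> : gact A g^-1%g b = 0 by rewrite (is_lin0 (gactL _ _)).
  apply: Af; apply/funext => c; rewrite amul0l.
  by apply/eqP; apply: contrapT => /negP; exact: nc.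
have [c bc0] := bgc.
pose x : fam I A := elt (basis C i) b.
have xi j : j \notin [fset i]%fset -> coef x j = 0.
  by rewrite in_fset1 coef_elt coef_basis => /negPf ->; rewrite scale0r.
have [y yE] := inv g^-1%g _ (ex_intro _ x erefl).
have [D yD] := fam_supp y; exists D => j jD.
have := congr1 (fun f => f (elt (basis C j) c)) yE.
rewrite /= (coord_fspaceE _ xi) (coord_fspaceE _ yD) big_seq_fset1.
rewrite big1_seq => [|k /= kD]; last first.
  rewrite coef_elt coef_basis; case: eqP => [kj|_].
    by rewrite kj (negPf jD) in kD.
  by rewrite scale0r amul0r.
rewrite /coord_act tens_elt ?invgK; [|exact: fractL|exact: gactL].
rewrite !coef_elt coef_basis eqxx scale1r amulZr (is_linZ (gactL _ _)).
rewrite gact_mul -gactM mulVg gact1 => /eqP.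
by rewrite scaler_eq0 (negPf bc0) orbF => /eqP.
Qed.

End free_actions.
End matrix_action_constructions.

(** * Transport of compact operators to matrices *)

Section blocks.
Variables (R : realType) (G : groupType) (A : galgebra R G).
Local Notation C := R[i].

Section compact_theory.
Variable M : fmodule A.
Implicit Types k : compact_galg M.

Definition presents k (J : finType) (eta : J -> M) (phi : J -> M -> A) :=
  (forall r, fspace (phi r)) /\
  op k = fun x => \sum_r theta (eta r) (phi r) x.

Lemma presents_exists k :
  exists (J : finType) (eta : J -> M) (phi : J -> M -> A), presents k eta phi.
Proof. exact: opP k. Qed.

Lemma op_sum (T : Type) (s : seq T) (F : T -> compact_galg M) x :
  op (\sum_(t <- s) F t) x = \sum_(t <- s) op (F t) x.
Proof. by rewrite /op lsub_val_sum fct_sumE. Qed.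

Lemma opZ c k x : op (c *: k) x = c *: op k x.
Proof. by rewrite /op lsub_valZ. Qed.

Lemma op0 x : op (0 : compact_galg M) x = 0.
Proof. by rewrite /op lsub_val0. Qed.

Lemma rmod_hom0 (N N' : rmodule A) (f : N -> N') : rmod_hom f -> f 0 = 0.
Proof. by move=> [fD _]; apply: (addrI (f 0)); rewrite -fD !addr0. Qed.

Lemma fm_act0 g : fm_act g (0 : M) = 0.
Proof. by apply: (addrI (fm_act g 0)); rewrite -fm_actD !addr0. Qed.

Lemma rmul0l a : rmul (0 : M) a = 0.
Proof. exact: is_lin0 (rmulLl a). Qed.

Lemma rmul0r (x : M) : rmul x (0 : A) = 0.
Proof. exact: is_lin0 (rmulLr x). Qed.

Lemma compact_lcomp (f : M -> M) (k : M -> M) :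
  rmod_hom f -> @compact _ _ _ M M k -> @compact _ _ _ M M (f \o k).
Proof.
move=> fh [J [eta [phi [phiT ->]]]]; exists J, (f \o eta), phi; split=> //.
apply/funext => x; rewrite /= (rmod_hom_sum _ _ fh).
by apply: eq_bigr => r _; rewrite /theta fh.2.
Qed.

Definition lcomp (f : M -> M) (fh : rmod_hom f) k : compact_galg M :=
  mkop (compact_lcomp fh (opP k)).

End compact_theory.

Variables (I : choiceType) (d : matrix_action R G I) (M N : fmodule A).
Local Notation matK := (mat_galg (compact_galg N) (conj_action d)).

(** The components of an equivariant map [M -> C^I (x) N] of right modules. *)
Record column_map (W : I -> M -> N) : Prop := ColumnMap {
  cm_hom : forall i, rmod_hom (W i);
  cm_supp : forall x, exists D : {fset I}, forall i, i \notin D -> W i x = 0;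
  cm_act : forall g i x, W i (fm_act g x) =
    \sum_(j \in [set: I]) d g i j *: fm_act g (W j x) }.

(** The components of an equivariant map from the functionals on [M] to those on
    [C^I (x) N]; [rm_ext] is the approximation property of functional extensions,
    required at each coordinate separately. *)
Record row_map (Ws : I -> (M -> A) -> N -> A) : Prop := RowMap {
  rm_fspace : forall l phi, fspace phi -> fspace (Ws l phi);
  rm_supp : forall phi, fspace phi -> exists D : {fset I},
    forall l, l \notin D -> forall y, Ws l phi y = 0;
  rm_act : forall g l phi y, fspace phi ->
    Ws l (fun x => gact A g (phi (fm_act g^-1%g x))) y =
    \sum_(k \in [set: I]) d g^-1%g k l *:
      gact A g (Ws k phi (fm_act g^-1%g y));
  rm_ext : forall (J : finType) (phi : J -> M -> A) l y,
    (forall r, fspace (phi r)) -> exists x, forall r, Ws l (phi r) y = phi r x }.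

Section block.
Variables (W : I -> M -> N) (Ws : I -> (M -> A) -> N -> A).
Hypotheses (Wc : column_map W) (Wr : row_map Ws).

Lemma common_column_supp (J : finType) (eta : J -> M) : exists D : {fset I},
  forall i r, i \notin D -> W i (eta r) = 0.
Proof.
have [D WD] := @common_fset I J (fun r i => W i (eta r) = 0)
  (fun r => cm_supp Wc (eta r)).
by exists D => i r; exact: WD.
Qed.

Lemma common_row_supp (J : finType) (phi : J -> M -> A) :
  (forall r, fspace (phi r)) -> exists D : {fset I},
  forall l r, l \notin D -> forall y, Ws l (phi r) y = 0.
Proof.
move=> phiT; have [D WD] := @common_fset I J
  (fun r l => forall y, Ws l (phi r) y = 0) (fun r => rm_supp Wr (phiT r)).
by exists D => i r; exact: WD.
Qed.

(** The sum depends on the operator only, not on its presentation. *)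
Lemma block_sumE (J : finType) (eta : J -> M) (phi : J -> M -> A) k i l y x :
  presents k eta phi -> (forall r, Ws l (phi r) y = phi r x) ->
  \sum_r rmul (W i (eta r)) (Ws l (phi r) y) = W i (op k x).
Proof.
move=> [phiT ->] xE; rewrite (rmod_hom_sum _ _ (cm_hom Wc i)).
by apply: eq_bigr => r _; rewrite /theta (cm_hom Wc i).2 xE.
Qed.

Definition block_spec (k : compact_galg M) (X : matK) :=
  forall (J : finType) (eta : J -> M) (phi : J -> M -> A), presents k eta phi ->
  forall i l y, op (coef X (i, l)) y =
    \sum_r rmul (W i (eta r)) (Ws l (phi r) y).

(** Two presentations of [k] are compared by applying [rm_ext] to the functionals
    of both at once. *)
Lemma block_exists k : exists X, block_spec k X.
Proof.
have [J [eta [phi kE]]] := presents_exists k; have phiT := kE.1.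
have kC p : @compact _ _ _ N N
    (fun y => \sum_r theta (W p.1 (eta r)) (Ws p.2 (phi r)) y).
  exists J, (fun r => W p.1 (eta r)), (fun r => Ws p.2 (phi r)).
  by split=> // r; exact: rm_fspace.
have [D WD] := common_column_supp eta.
have [D' WD'] := common_row_supp phiT.
have Xf : @finitely_supported _ (I * I)%type (compact_galg N)
    (fun p => mkop (kC p)).
  apply/finitely_supportedP; exists (D `*` D')%fset => -[i l].
  rewrite in_fsetM negb_and /= => il; apply: op_inj => y; rewrite op0.
  apply: big1 => r _; rewrite /theta.
  case/orP: il => [iD|lD]; first by rewrite WD// rmul0l.
  by rewrite WD'// rmul0r.
exists (mkfam Xf) => J' eta' phi' kE' i l y.
have phiT' := kE'.1.
pose psi (r : J + J') := match r with inl r => phi r | inr r => phi' r end.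
have [|x xE] := rm_ext Wr (phi := psi) l y; first by case.
rewrite (block_sumE i kE' (fun r => xE (inr r))).
exact: block_sumE (fun r => xE (inl r)).
Qed.

(** The matrix of [theta_(W eta, Ws phi)] when [k] is [theta_(eta, phi)]. *)
Definition block (k : compact_galg M) : matK := projT1 (cid (block_exists k)).

Lemma blockP k : block_spec k (block k).
Proof. exact: projT2 (cid _). Qed.

Lemma block_eq k X (J : finType) (eta : J -> M) (phi : J -> M -> A) :
  presents k eta phi ->
  (forall i l y, op (coef X (i, l)) y =
    \sum_r rmul (W i (eta r)) (Ws l (phi r) y)) ->
  block k = X.
Proof.
move=> kE XE; apply: fam_inj => -[i l]; apply: op_inj => y.
by rewrite XE (blockP kE).
Qed.

Lemma block_lin : is_lin block.
Proof.
move=> c k k'.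
have [J [eta [phi kE]]] := presents_exists k.
have [J' [eta' [phi' kE']]] := presents_exists k'.
pose eta2 (r : J + J') :=
  match r with inl r => c *: eta r | inr r => eta' r end.
pose phi2 (r : J + J') := match r with inl r => phi r | inr r => phi' r end.
have k2E : presents (c *: k + k') eta2 phi2.
  split; first by case=> r; [exact: kE.1|exact: kE'.1].
  apply/funext => x; rewrite opL kE.2 kE'.2 big_sumType /= scaler_sumr.
  by congr (_ + _); apply: eq_bigr => r _; rewrite /theta rmulZl.
apply: (block_eq k2E) => i l y.
rewrite coefD coefZ opL (blockP kE) (blockP kE') big_sumType /= scaler_sumr.
congr (_ + _).
(* W is only additive, but c passes through W next to the value phi r x, where
   it can be absorbed by an element of A. *)
have [x xE] := rm_ext Wr l y kE.1.
apply: eq_bigr => r _.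
by rewrite -(rmulZr c) xE -!(cm_hom Wc i).2 rmulZl rmulZr.
Qed.

Lemma block_act g k :
  block (gact (compact_galg M) g k) = gact matK g (block k).
Proof.
have [J [eta [phi kE]]] := presents_exists k; have phiT := kE.1.
have gkE : presents (gact (compact_galg M) g k) (fun r => fm_act g (eta r))
    (fun r x => gact A g (phi r (fm_act g^-1%g x))).
  split=> [r|]; first exact: fspace_act.
  apply/funext => x; rewrite op_act kE.2 fm_act_sum.
  by apply: eq_bigr => r _; rewrite /theta fm_act_rmul.
apply: (block_eq gkE) => i l y.
have [D1 WD1] := common_column_supp eta.
have [D2 WD2] := common_row_supp phiT.
have WD j r : j \notin (D1 `|` D2)%fset -> W j (eta r) = 0.
  by rewrite in_fsetU negb_or => /andP[/WD1 ->].
have WsD j r z : j \notin (D1 `|` D2)%fset -> Ws j (phi r) z = 0.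
  by rewrite in_fsetU negb_or => /andP[_ /WD2 ->].
have XD j j' : (j \notin (D1 `|` D2)%fset) || (j' \notin (D1 `|` D2)%fset) ->
    coef (block k) (j, j') = 0.
  move=> jj'; apply: op_inj => z; rewrite op0 (blockP kE) big1// => r _.
  case/orP: jj' => [jD|jD]; first by rewrite WD// rmul0l.
  by rewrite WsD// rmul0r.
rewrite (congr1 (fun k' => op k' y) (coef_conj_act g i l XD)).
rewrite op_sum; under eq_bigr => j _.
  rewrite op_sum; under eq_bigr => j' _.
    rewrite opZ op_act (blockP kE) fm_act_sum scaler_sumr.
    under eq_bigr do rewrite fm_act_rmul.
    over.
  rewrite exchange_big; over.
rewrite exchange_big; apply: eq_bigr => r _ /=.
rewrite (cm_act Wc) (rm_act Wr)//.
rewrite (fsbigTE (D1 `|` D2)%fset) => [|j /WD ->]; last first.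
  by rewrite fm_act0 scaler0.
rewrite (fsbigTE (D1 `|` D2)%fset) => [|j /WsD ->]; last first.
  by rewrite (is_lin0 (gactL _ _)) scaler0.
rewrite (is_lin_sum (rmulLl _)); apply: eq_bigr => j _.
rewrite rmul_sumr; apply: eq_bigr => j' _.
by rewrite rmulZl rmulZr scalerA.
Qed.

End block.

(** [theta_(W eta, Ws phi) theta_(W' eta', Ws' phi')] is
    [theta_(W eta <Ws phi, W' eta'>, Ws' phi')], and the pairing in the middle is
    [phi (eps eta')]. *)
Lemma block_mul (W W' : I -> M -> N) (Ws Ws' : I -> (M -> A) -> N -> A)
    (Wc : column_map W) (Wr : row_map Ws)
    (Wc' : column_map W') (Wr' : row_map Ws')
    (eps : M -> M) (eps_hom : rmod_hom eps) k k' :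
  (forall phi x, fspace phi ->
    \sum_(j \in [set: I]) Ws j phi (W' j x) = phi (eps x)) ->
  amul (block Wc Wr k) (block Wc' Wr' k') =
  block Wc Wr' (amul k (lcomp eps_hom k')).
Proof.
move=> pairing; apply/esym.
have [J [eta [phi kE]]] := presents_exists k; have phiT := kE.1.
have [J' [eta' [phi' kE']]] := presents_exists k'.
have k2E : presents (amul k (lcomp eps_hom k'))
    (fun s => op k (eps (eta' s))) phi'.
  split=> [s|]; first exact: kE'.1.
  apply/funext => x; rewrite op_mul /= /lcomp /op/= -/(op k _) -/(op k' _).
  rewrite kE'.2 (rmod_hom_sum _ _ eps_hom).
  rewrite (rmod_hom_sum _ _ (compact_hom (opP k))).
  by apply: eq_bigr => s _; rewrite /theta eps_hom.2 (compact_hom (opP k)).2.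
apply: (block_eq Wc Wr' k2E) => i l y.
have [D WD] := common_row_supp Wr phiT.
have XD j : j \notin D ->
    coef (block Wc Wr k) (i, j) = 0 \/ coef (block Wc' Wr' k') (j, l) = 0.
  move=> jD; left; apply: op_inj => z; rewrite op0 (blockP _ _ kE).
  by rewrite big1// => r _; rewrite WD// rmul0r.
rewrite (congr1 (fun z => op z y) (mat_mulE XD)).
rewrite op_sum; under eq_bigr => j _.
  rewrite op_mul (blockP _ _ kE') (rmod_hom_sum _ _ (compact_hom (opP _))).
  under eq_bigr => s _.
    rewrite (compact_hom (opP _)).2 (blockP _ _ kE) (is_lin_sum (rmulLl _)).
    under eq_bigr do rewrite -rmulA.
    over.
  over.
rewrite exchange_big; apply: eq_bigr => s _ /=.
rewrite exchange_big /= kE.2 (rmod_hom_sum _ _ (cm_hom Wc i)).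
rewrite (is_lin_sum (rmulLl _)); apply: eq_bigr => r _.
rewrite /theta (cm_hom Wc i).2 -pairing// (fsbigTE D) => [|j jD]; last first.
  exact: WD.
by rewrite -rmul_sumr -amul_suml -rmulA.
Qed.

End blocks.

(** * Paths of homomorphisms *)

Section smooth_functions.
Variable R : realType.

Lemma smooth_real_cst (c : R) : smooth_real (fun=> c).
Proof.
pose P (f : R -> R) := exists c, f = fun=> c.
apply: (@smooth_real_coind _ P); last by exists c.
move=> _ [b ->]; split; first by move=> x; exact: derivable_cst.
by exists 0; apply/funext => x; rewrite derive1_cst.
Qed.

Lemma smooth_real_id : smooth_real (id : R -> R).
Proof.
apply/smooth_realS; split; first by move=> x; exact: derivable_id.
suff -> : derive1 (id : R -> R) = fun=> 1 by exact: smooth_real_cst.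
by apply/funext => x; rewrite derive1_id.
Qed.

Lemma smooth_real_complex (f : R -> R) :
  smooth_real f -> smooth (fun t => (f t)%:C%C).
Proof. by move=> fs; split; [exact: fs|exact: smooth_real_cst]. Qed.

End smooth_functions.

(** A family of mutually orthogonal pairs of a column map and a row map, with
    weights [p] and [q]. The functional space need not be stable under scalars,
    so the weights are attached to the matrices [block (W a) (Ws b)]. The products
    of [q a] and [p a] add up to a decomposition of the identity of [M] by
    [pq_eps], which makes the weighted sum multiplicative. *)
Section block_paths.
Variables (R : realType) (G : groupType) (A : galgebra R G).
Local Notation C := R[i].
Variables (I : choiceType) (d : matrix_action R G I) (M N : fmodule A).
Variables (T : finType) (W : T -> I -> M -> N).
Variables (Ws : T -> I -> (M -> A) -> N -> A).
Hypotheses (Wc : forall a, column_map d (W a)).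
Hypotheses (Wr : forall a, row_map d (Ws a)).
Variables (eps : T -> M -> M) (eps_hom : forall a, rmod_hom (eps a)).
Hypothesis pairing_diag : forall a phi x, fspace phi ->
  \sum_(j \in [set: I]) Ws a j phi (W a j x) = phi (eps a x).
Hypothesis pairing_off : forall a b j phi x, a != b -> fspace phi ->
  Ws a j phi (W b j x) = 0.
Variables (p q : T -> R -> R).
Hypotheses (p_smooth : forall a, smooth_real (p a)).
Hypotheses (q_smooth : forall a, smooth_real (q a)).
Hypothesis pq_eps : forall t x,
  \sum_a (q a t * p a t)%:C%C *: eps a x = x.

Local Notation matK := (mat_galg (compact_galg N) (conj_action d)).
Local Notation blk a b := (block (Wc a) (Wr b)).

Definition block_weight (ab : T * T) (t : R) : C := (p ab.1 t * q ab.2 t)%:C%C.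

Lemma smooth_block_path k : smooth_path (A := matK)
  (fun t => \sum_(ab : T * T) block_weight ab (val t) *: blk ab.1 ab.2 k).
Proof.
exists (T * T)%type, block_weight, (fun ab => blk ab.1 ab.2 k); split=> // ab.
by apply: smooth_real_complex; apply: smooth_realM.
Qed.

Definition block_path (k : compact_galg M) : path_galg matK :=
  @mklsub _ _ (path_space matK) _ (smooth_block_path k).

Lemma block_pathE t k : path_eval t (block_path k) =
  \sum_a \sum_b block_weight (a, b) (val t) *: blk a b k.
Proof.
by rewrite (pair_bigA _ (fun a b => block_weight (a, b) (val t) *: blk a b k)).
Qed.

Lemma block_path_lin : is_lin block_path.
Proof.
move=> c k k'; apply: path_inj => t; rewrite path_evalL !block_pathE.
rewrite scaler_sumr -big_split; apply: eq_bigr => a _.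
rewrite /= scaler_sumr -big_split; apply: eq_bigr => b _ /=.
by rewrite block_lin scalerDr !scalerA mulrC.
Qed.

Lemma block_path_act g k :
  block_path (gact (compact_galg M) g k) =
  gact (path_galg matK) g (block_path k).
Proof.
apply: path_inj => t.
transitivity (gact matK g (path_eval t (block_path k))); last by [].
rewrite !block_pathE; have gl := gactL (gact matK) g.
rewrite (is_lin_sum gl); apply: eq_bigr => a _.
rewrite (is_lin_sum gl); apply: eq_bigr => b _.
by rewrite (is_linZ gl) block_act.
Qed.

Lemma lcomp_decomp t (k : compact_galg M) :
  k = \sum_a (q a t * p a t)%:C%C *: lcomp (eps_hom a) k.
Proof.
apply: op_inj => x; rewrite op_sum -[LHS](pq_eps t).
by apply: eq_bigr => a _; rewrite opZ.
Qed.

Lemma block_mul_diag a b c k k' :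
  amul (blk a b k) (blk b c k') = blk a c (amul k (lcomp (eps_hom b) k')).
Proof. by apply: block_mul => phi x; exact: pairing_diag. Qed.

Lemma block_mul_off a b b' c k k' : b != b' ->
  amul (blk a b k) (blk b' c k') = 0.
Proof.
move=> bb'; have hom0 : @rmod_hom _ _ A M M (fun=> 0).
  by split=> *; rewrite ?addr0 ?rmul0l.
rewrite (block_mul _ _ _ _ hom0); last first.
  move=> phi x phiT; rewrite (rmod_hom0 (fspace_hom phiT)).
  by apply: fsbig1 => j _; exact: pairing_off.
suff -> : amul k (lcomp hom0 k') = 0 by exact: is_lin0 (block_lin _ _).
apply: op_inj => x; rewrite op0 op_mul.
exact: rmod_hom0 (compact_hom (opP k)).
Qed.

Lemma block_path_mul k k' :
  block_path (amul k k') = amul (block_path k) (block_path k').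
Proof.
apply: path_inj => t.
transitivity (amul (path_eval t (block_path k)) (path_eval t (block_path k')));
  last by [].
rewrite !block_pathE.
rewrite amul_suml; apply: eq_bigr => a _.
have lin c := block_lin (Wc a) (Wr c).
transitivity (\sum_c \sum_b block_weight (a, b) (val t) *:
    (block_weight (b, c) (val t) *: amul (blk a b k) (blk b c k'))).
  apply: eq_bigr => c _; rewrite [in LHS](lcomp_decomp (val t) k').
  rewrite amul_sumr (is_lin_sum (lin c)) scaler_sumr; apply: eq_bigr => b _.
  rewrite amulZr (is_linZ (lin c)) block_mul_diag !scalerA; congr (_ *: _).
  rewrite /block_weight /= -!rmorphM; congr (_%:C%C); ring.
rewrite exchange_big amul_suml; apply: eq_bigr => b _.
rewrite amul_sumr [RHS](big_only1 b)// => [|b' b'b _].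
  rewrite amul_sumr; apply: eq_bigr => c _.
  by rewrite amulZl amulZr.
rewrite amul_sumr big1// => c _.
by rewrite amulZl amulZr block_mul_off 1?eq_sym// !scaler0.
Qed.

Definition block_path_hom : ghom (compact_galg M) (path_galg matK) :=
  @GHom _ _ (compact_galg M) (path_galg matK) block_path
    block_path_lin block_path_mul block_path_act.

End block_paths.

(** * The rotation *)

(** The three orthogonal ways to place a part of [P = E (+) B] in
    [C^(n+1) (x) P]: the summand [B] at the new coordinate, the summand [E] at the
    new coordinate, and [E] at the old coordinates through [V]. *)
Variant summand := Fixed | Source | Target.

Definition summand_code (a : summand) : option bool :=
  match a with Fixed => None | Source => Some false | Target => Some true end.

Definition summand_decode (x : option bool) : summand :=
  match x with None => Fixed | Some b => if b then Target else Source end.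

Lemma summand_codeK : cancel summand_code summand_decode.
Proof. by case. Qed.

HB.instance Definition _ := Finite.copy summand (can_type summand_codeK).

Lemma big_summand (V : nmodType) (F : summand -> V) :
  \sum_a F a = F Fixed + F Source + F Target.
Proof.
have decodeK : cancel summand_decode summand_code by case=> [[]|].
rewrite (reindex summand_decode) /=; last first.
  by exists summand_code => x _; [exact: decodeK|exact: summand_codeK].

rewrite /index_enum !unlock /= /index_enum !unlock /=.
by rewrite addr0 addrA addrAC.
Qed.

Section rotation.
Variables (R : realType) (G : groupType) (B : galgebra R G).
Local Notation C := R[i].
Variables (I : choiceType) (delta : free_action R G I).
Variables (inv : coord_invariant B delta) (E : fmodule B).
Variables (V : E -> coord_fmodule inv) (Vs : (E -> B) -> coord_fmodule inv -> B).
Hypothesis hV : functional_extension V Vs.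
Hypothesis delta_row : row_finite delta.

Let V_hom : fmod_hom V Vs := let: And3 h _ _ := hV in h.
Local Notation P := (dsum E (self_fmodule B)).
Local Notation d := (option_action (free_matrix_action delta_row)).

Definition placement (a : summand) (i : option I) (x : P) : P :=
  match a, i with
  | Fixed, None => (0, x.2)
  | Source, None => (x.1, 0)
  | Target, Some i => (0, coef (V x.1) i)
  | _, _ => 0
  end.

Definition coplacement (a : summand) (j : option I) (phi : P -> B) (y : P) :
    B :=
  match a, j with
  | Fixed, None => phi (0, y.2)
  | Source, None => phi (y.1, 0)
  | Target, Some j => Vs (fun xi => phi (xi, 0)) (elt (basis C j) y.2)
  | _, _ => 0
  end.

Definition component (a : summand) (x : P) : P :=
  if a is Fixed then (0, x.2) else (x.1, 0).

Lemma fspace_dsumP (phi : P -> B) : fspace phi ->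
  exists b, [/\ fspace (fun xi => phi (xi, 0)), forall y, phi (0, y) = amul b y
    & forall x, phi x = phi (x.1, 0) + phi (0, x.2)].
Proof.
move=> [chi [_ [chiT [b ->] phiE]]]; have chi0 := rmod_hom0 (fspace_hom chiT).
have phi1 : (fun xi => phi (xi, 0)) = chi.
  by apply/funext => xi; rewrite phiE amul0r addr0.
exists b; split=> [|y|x]; first by rewrite phi1.
  by rewrite phiE /= chi0 add0r.
by rewrite phiE /= amul0r chi0 addr0 add0r.
Qed.

Lemma fspace_dsum0 (phi : P -> B) : fspace phi -> phi (0, 0) = 0.
Proof. by move=> /fspace_hom/rmod_hom0. Qed.

Lemma star_coef (phi : E -> B) : fspace phi -> exists x : fam I B,
  forall j b, Vs phi (elt (basis C j) b) = amul (coef x j) b.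
Proof.
move=> /(fmh_star V_hom)[x ->]; exists x => j b.
rewrite (fsbigTE [fset j]%fset) => [|k].
  by rewrite big_seq_fset1 coef_elt coef_basis eqxx scale1r.
by rewrite in_fset1 coef_elt coef_basis => /negPf ->; rewrite scale0r amul0r.
Qed.

(** [Vs phi] acts by left multiplications with elements of [B]; [phi] itself is
    only additive. *)
Lemma star_lin (phi : E -> B) : fspace phi ->
  is_lin (Vs phi : fam I B -> B).
Proof.
move=> /(fmh_star V_hom)[x ->] c u v; have [D xD] := fam_supp x.
rewrite !(coord_fspaceE _ xD) scaler_sumr -big_split; apply: eq_bigr => j _ /=.
by rewrite coefD coefZ amulLr.
Qed.

Lemma scale_pairE (M N : lmodType C) (c : C) (x : M) (y : N) :
  c *: (x, y) = (c *: x, c *: y).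
Proof. by []. Qed.

Lemma placement_hom a i : rmod_hom (placement a i).
Proof.
have [VD VM] := fmh_hom V_hom.
split=> [x y|x b]; case: a i => [] [i|] /=; rewrite ?VD ?VM ?coefD;
  by apply: injective_projections; rewrite /= ?addr0 ?rmul0l ?amul0l.
Qed.

Lemma column_map_placement a : column_map d (placement a).
Proof.
split=> [|x|g i x]; first exact: placement_hom.
  case: a => [||]; try by apply: (@some_fset _ _ fset0) => i _.
  have [D VD] := fam_supp (V x.1); apply: (some_fset (D := D)) => i /VD.
  by rewrite /= => ->.
have [D VD] := fam_supp (V x.1).
have colD j : j \notin D -> placement a (Some j) x = 0.
  by move=> jD; case: a => //=; rewrite VD.
rewrite (fsbig_option (A := D)) => [|j /colD ->]; last first.
  by rewrite fm_act0 scaler0.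
have g0 : dsum_act g (0 : P) = 0 := @fm_act0 _ _ _ P g.
case: a i {colD} => [] [i|] /=; rewrite ?g0 ?scaler0 ?scale0r ?scale1r ?add0r.
- by rewrite big1// => j _; rewrite scaler0.
- by rewrite big1 ?addr0// /dsum_act /= fm_act0.
- by rewrite big1// => j _; rewrite scaler0.
- by rewrite big1 ?addr0// /dsum_act /= (is_lin0 (gactL _ _)).
- rewrite (fmh_act V_hom) /= /coord_act.
  rewrite (tensE (delta g) (is_lin0 (gactL _ g)) VD).
  rewrite coef_sum (is_lin_sum (@inr_lin _ _ _ E)); apply: eq_bigr => j _.
  by rewrite coef_elt /dsum_act /= fm_act0 scale_pairE scaler0.
- by rewrite big1// => j _; rewrite scale0r.
Qed.

Lemma row_map_coplacement a : row_map d (coplacement a).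
Proof.
have [_ _ ext] := hV.
split=> [l phi phiT|phi phiT|g l phi y phiT|J phi l y phiT].
- have [b [phi1 phi2 _]] := fspace_dsumP phiT.
  case: a l => [] [l|] /=; try exact: (@fspace0 _ _ _ P).
  + exists (fun=> 0), (amul b); split; [exact: fspace0|by exists b|].
    by apply/funext => y; rewrite /= phi2 add0r.
  + exists (fun xi => phi (xi, 0)), (fun=> 0); split=> //; first exact: fspace0.
    by apply/funext => y; rewrite /= addr0.
  + have [x xE] := star_coef phi1.
    exists (fun=> 0), (amul (coef x l)).
    split; [exact: fspace0|by exists (coef x l)|].
    by apply/funext => y; rewrite /= xE add0r.
- have [b [phi1 _ _]] := fspace_dsumP phiT.
  case: a => [||]; try by apply: (@some_fset _ _ fset0) => i _.
  have [x xE] := star_coef phi1; have [D xD] := fam_supp x.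
  by apply: (some_fset (D := D)) => i /xD xi y /=; rewrite xE xi amul0l.
- have [b [phi1 _ _]] := fspace_dsumP phiT.
  have [D gD] : exists D : {fset I}, forall k, k \notin D ->
      d g^-1%g (Some k) l = 0.
    case: l => [l|]; last by exists fset0.
    exact: (mact_col (free_matrix_action delta_row) g^-1%g l).
  rewrite (fsbig_option (A := D)) => [|k kD]; last by rewrite gD// scale0r.
  have g0 := is_lin0 (gactL (gact B) g).
  case: a l gD => [] [l|] gD /=;
    rewrite ?g0 ?scaler0 ?add0r ?scale1r ?scale0r ?add0r.
  + by rewrite big1// => j _; rewrite scaler0.
  + by rewrite big1 ?addr0 ?scale0r// /dsum_act /= fm_act0.
  + by rewrite big1// => j _; rewrite scaler0.
  + rewrite big1 ?addr0 ?scale0r// /dsum_act /=.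
    by rewrite (is_lin0 (gactL _ _)).
  + rewrite /dsum_act /=.
    rewrite (_ : (fun xi => _) =
        (fun xi => gact B g (phi (fm_act g^-1%g xi, 0)))); last first.
      by apply/funext => xi; rewrite (is_lin0 (gactL _ _)).
    rewrite (fmh_star_act V_hom g phi1) /= /coord_act.
    rewrite tens_elt; [|exact: fractL|exact: gactL].
    have dD k : k \notin D ->
        coef (elt (delta g^-1%g (basis C l)) (gact B g^-1%g y.2)) k = 0.
      by move=> /gD /= kl; rewrite coef_elt kl scale0r.
    rewrite (fam_decomp dD) (is_lin_sum (star_lin phi1)).
    rewrite (is_lin_sum (gactL _ g)); apply: eq_bigr => k _.
    rewrite coef_elt -eltZ /free_matrix_action /=.
    rewrite -(is_linZ (gactL _ g)) -(is_linZ (star_lin phi1)).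
    congr (gact B g (Vs _ _)).
    by apply: fam_inj => j; rewrite coefZ !coef_elt coefZ scalerA.
  + by rewrite big1// => j _; rewrite scale0r.
- case: a l => [] [l|] /=; try by exists 0 => r; rewrite fspace_dsum0.
  + by exists (0, y.2).
  + by exists (y.1, 0).
  + have [|x xE] := ext J (fun r xi => phi r (xi, 0)) (elt (basis C l) y.2).
      by move=> r; have [b []] := fspace_dsumP (phiT r).
    by exists (x, 0).
Qed.

Lemma component_hom a : rmod_hom (component a).
Proof.
split=> [x y|x b]; case: a; apply: injective_projections;
  by rewrite /= ?addr0 ?rmul0l ?amul0l.
Qed.

Lemma coplacement_placement_diag a phi x : fspace phi ->
  \sum_(j \in [set: option I]) coplacement a j phi (placement a j x) =
  phi (component a x).
Proof.
move=> phiT; have [b [phi1 _ _]] := fspace_dsumP phiT.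
have [D VD] := fam_supp (V x.1).
have star0 := is_lin0 (star_lin phi1).
rewrite (fsbig_option (A := D)) => [|j jD]; last first.
  by case: a => //=; rewrite VD// elt0 star0.
case: a => /=; rewrite ?add0r; try by rewrite big1 ?addr0.
by rewrite -(is_lin_sum (star_lin phi1)) -(fam_decomp VD) (fmh_pair V_hom).
Qed.

Lemma coplacement_placement_off a b j phi x : a != b -> fspace phi ->
  coplacement a j phi (placement b j x) = 0.
Proof.
move=> ab phiT; have [c [phi1 _ _]] := fspace_dsumP phiT.
have phi0 := fspace_dsum0 phiT; have star0 := is_lin0 (star_lin phi1).
by case: a b j ab => [] [] [j|] //= _; rewrite ?elt0 ?star0.
Qed.

(** The products of the weights of [Source] and of [Target] add up to
    [(1 - t^2)^2 + t^2 (2 - t^2) = 1]; of these two, only [Source] survives at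
    [t = 0] and only [Target] at [t = 1]. *)
Definition col_weight (a : summand) (t : R) : R :=
  match a with Fixed => 1 | Source => 1 - t * t | Target => t end.

Definition row_weight (a : summand) (t : R) : R :=
  match a with Fixed => 1 | Source => 1 - t * t | Target => t * (2 - t * t) end.

Lemma smooth_real_sub_sq (c : R) : smooth_real (fun t : R => c - t * t).
Proof.
have -> : (fun t : R => c - t * t) = (fun=> c) - (id * id) :> (R -> R).
  by apply/funext => t; rewrite addrfctE opprfctE mulrfctE.
apply: smooth_realD; first exact: smooth_real_cst.
by apply: smooth_realN; apply: smooth_realM; exact: smooth_real_id.
Qed.

Lemma col_weight_smooth a : smooth_real (col_weight a).
Proof.
case: a; [exact: smooth_real_cst|exact: smooth_real_sub_sq|exact: smooth_real_id].
Qed.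

Lemma row_weight_smooth a : smooth_real (row_weight a).
Proof.
case: a; [exact: smooth_real_cst|exact: smooth_real_sub_sq|].
by apply: smooth_realM; [exact: smooth_real_id|exact: smooth_real_sub_sq].
Qed.

Lemma weight_component t (x : P) :
  \sum_a (row_weight a t * col_weight a t)%:C%C *: component a x = x.
Proof.
rewrite big_summand /= -addrA -scalerDl -rmorphD /=.
have -> : (1 - t * t) * (1 - t * t) + t * (2 - t * t) * t = 1 by ring.
rewrite mulr1 !scale1r.
by apply: injective_projections; rewrite /= ?addr0 ?add0r.
Qed.

Lemma sum_block_weight (U : lmodType C) (X : summand -> summand -> U) a t :
  (a = Source /\ t = 0) \/ (a = Target /\ t = 1) ->
  \sum_b \sum_c block_weight col_weight row_weight (b, c) t *: X b c =
  X Fixed Fixed + X Fixed a + (X a Fixed + X a a).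
Proof.
move=> atE; rewrite !big_summand /block_weight.
case: atE => -[-> ->] /=.
  by rewrite !(mul0r, mulr0, subr0, mulr1, scale0r, scale1r, addr0).
rewrite !(mul0r, mulr0, mulr1, mul1r) subrr (_ : 2 - 1 = 1 :> R); last by ring.
by rewrite !(mul0r, mulr0, mulr1, scale0r, scale1r, addr0, add0r).
Qed.

Definition rotation_path : ghom (compact_galg P)
    (path_galg (mat_galg (compact_galg P) (conj_action d))) :=
  block_path_hom column_map_placement row_map_coplacement component_hom
    coplacement_placement_diag coplacement_placement_off
    col_weight_smooth row_weight_smooth
    weight_component.

End rotation.

(** * Entrywise homomorphisms and factorizations *)

Section entrywise.
Variables (R : realType) (G : groupType) (A D : galgebra R G).
Local Notation C := R[i].
Variables (I : choiceType) (gamma : gaction G (mat_alg I (complex_alg R))).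
Variable f : ghom A D.

Let fL := ghomL f.
Let f0 : f 0 = 0 := is_lin0 fL.

Definition mat_map : mat_galg A gamma -> mat_galg D gamma := tens id f.

Lemma coef_mat_map X p : coef (mat_map X) p = f (coef X p).
Proof.
have [E XE] := fam_supp X.
rewrite /mat_map (tensE _ f0 XE) coef_sum.
under eq_bigr do rewrite coef_elt coef_basis.
by apply: (coef_sum_basis (x := fun p => f (coef X p))) => i /XE ->.
Qed.

Lemma mat_map_mul X Y : mat_map (amul X Y) = amul (mat_map X) (mat_map Y).
Proof.
have [E XE] := mat_supp X; apply: fam_inj => -[i k]; rewrite coef_mat_map.
rewrite (mat_mulE (x := X) (D := E)) => [|j jE]; last first.
  by left; rewrite XE ?jE ?orbT.
rewrite (mat_mulE (x := mat_map X) (D := E)) => [|j jE]; last first.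
  by left; rewrite coef_mat_map XE ?jE ?orbT.
rewrite (is_lin_sum fL); apply: eq_bigr => j _.
by rewrite ghom_mul !coef_mat_map.
Qed.

Lemma mat_map_act g X :
  mat_map (gact (mat_galg A gamma) g X) =
  gact (mat_galg D gamma) g (mat_map X).
Proof.
have idL : is_lin (id : free C (I * I)%type -> free C (I * I)%type) by [].
rewrite /= /mat_map /mat_act; have gl := gamma_lin gamma g.
rewrite !tens_comp//; try exact: gactL.
by apply: eq_tens => // a; exact: ghom_act.
Qed.

Definition mat_hom : ghom (mat_galg A gamma) (mat_galg D gamma) :=
  @GHom _ _ (mat_galg A gamma) (mat_galg D gamma) mat_map
    (tens_lin id fL) mat_map_mul mat_map_act.

Lemma mat_hom_inj : injective f -> injective mat_hom.
Proof.
move=> finj X Y XY; apply: fam_inj => p; apply: finj.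
by rewrite -!coef_mat_map; congr (coef _ p).
Qed.

Lemma mat_hom_image (X : mat_galg D gamma) : injective f ->
  (forall p, exists a, f a = coef X p) -> exists Y, mat_hom Y = X.
Proof.
move=> finj /choice[y yE].
have yf : @finitely_supported _ (I * I)%type A y.
  have [E XE] := fam_supp X; apply/finitely_supportedP; exists E => p /XE Xp.
  by apply: finj; rewrite yE Xp f0.
exists (mkfam yf); apply: fam_inj => p.
by rewrite -yE; exact: coef_mat_map.
Qed.

End entrywise.

Section homomorphisms.
Variables (R : realType) (G : groupType).

Lemma ghom_eq (A D : galgebra R G) (f h : ghom A D) : f =1 h -> f = h.
Proof.
case: f h => [f fL fM fA] [h hL hM hA] /= /funext fh; subst h.
by congr GHom; exact: Prop_irrelevance.
Qed.

Lemma ghom_factor (A D D' : galgebra R G) (f : ghom A D) (m : ghom D' D) :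
  injective m -> (forall a, exists x, m x = f a) ->
  exists h : ghom A D', ghom_comp m h = f.
Proof.
move=> minj /choice[h hE].
have hL : is_lin h.
  by move=> c u v; apply: minj; rewrite ghomL !hE ghomL.
have hM x y : h (amul x y) = amul (h x) (h y).
  by apply: minj; rewrite ghom_mul !hE ghom_mul.
have hA g x : h (gact A g x) = gact D' g (h x).
  by apply: minj; rewrite ghom_act !hE ghom_act.
by exists (GHom hL hM hA); apply: ghom_eq => a /=; rewrite hE.
Qed.

Definition ghom0 (A D : galgebra R G) : ghom A D.
Proof.
exists (fun=> 0) => [c u v|x y|g x]; first by rewrite scaler0 addr0.
  by rewrite amul0l.
by rewrite (is_lin0 (gactL _ g)).
Defined.

Lemma invertible_zero (L : algebra_category R G) (A D : {A | ob L A})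
    (f : ghom (sval A) (sval D)) :
  (forall x : sval A, x = 0) -> (forall x : sval D, x = 0) ->
  invertible (mor f).
Proof.
move=> A0 D0; exists (mor (ghom0 (sval D) (sval A))).
split; rewrite -mor_comp -mor_id; congr mor; apply: ghom_eq => x.
  by rewrite [LHS]A0 [RHS]A0.
by rewrite [LHS]D0 [RHS]D0.
Qed.

End homomorphisms.

(** * The endpoints of the rotation *)

Section endpoints.
Variables (R : realType) (G : groupType) (B : galgebra R G).
Local Notation C := R[i].
Variables (I : choiceType) (delta : free_action R G I).
Variables (inv : coord_invariant B delta) (E : fmodule B).
Variables (V : E -> coord_fmodule inv) (Vs : (E -> B) -> coord_fmodule inv -> B).
Hypothesis hV : functional_extension V Vs.
Hypothesis delta_row : row_finite delta.
Hypothesis Bq : quadratik B.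
Hypothesis Bf : left_faithful B.

Local Notation P := (dsum E (self_fmodule B)).
Local Notation d := (option_action (free_matrix_action delta_row)).
Local Notation e := (corner E Bq).
Local Notation blk a b :=
  (block (column_map_placement hV delta_row a)
     (row_map_coplacement hV delta_row b)).
Local Notation matK := (mat_galg (compact_galg P) (conj_action d)).

Lemma corner_inj : injective e.
Proof.
move=> a b ab; apply: Bf; apply/funext => c.
by have [] := congr1 (fun k : compact_galg P => op k ((0, c) : P)) ab.
Qed.

Lemma rotation_path_at a t k :
  (a = Source /\ val t = 0) \/ (a = Target /\ val t = 1) ->
  path_eval t (rotation_path hV delta_row k) =
  blk Fixed Fixed k + blk Fixed a k + (blk a Fixed k + blk a a k).
Proof.
by move=> atE; rewrite block_pathE (sum_block_weight _ atE).
Qed.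

(** Without [Target], everything is placed at the new coordinate. *)
Lemma rotation_path0 (k : compact_galg P) :
  path_eval (ui0 R) (rotation_path hV delta_row k) =
  elt (basis C (None, None)) k.
Proof.
rewrite (@rotation_path_at Source); last by left.
have [J [eta [phi kE]]] := presents_exists k.
apply: fam_inj => -[i l]; apply: op_inj => y.
rewrite !coefD coef_elt coef_basis xpair_eqE.
rewrite /op !lsub_valD lsub_valZ !addrfctE scalrfctE.
rewrite -![lsub_val _ y]/(op _ y) !(blockP _ _ kE) -!big_split /=.
have mul0l b : dsum_rmul (0 : P) b = 0 := rmul0l P b.
have mul0r (x : P) : dsum_rmul x 0 = 0 := rmul0r x.
case: i l => [i|] [l|] /=; rewrite ?scale0r ?scale1r.
- by rewrite big1// => r _; rewrite !mul0l !addr0.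
- by rewrite big1// => r _; rewrite !mul0l !addr0.
- by rewrite big1// => r _; rewrite !mul0r !addr0.
rewrite kE.2; apply: eq_bigr => r _.
have [b [_ _ phiE]] := fspace_dsumP (kE.1 r).
rewrite /theta /dsum_rmul /= !rmul0l !amul0l.
by apply: injective_projections;
  rewrite /= ?add0r ?addr0 -?rmulDr -?amulDr [phi r y]phiE addrC.
Qed.

(** The operators in [e B] do not touch [E], the only part that is rotated. *)
Lemma rotation_path1_corner a p :
  coef (path_eval (ui1 R) (rotation_path hV delta_row (e a))) p =
  e (coef (elt (basis C (None, None)) a) p).
Proof.
rewrite (@rotation_path_at Target); last by right.
have [J [x [y aE]]] := Bq a.
have eaE : presents (e a) (fun r => (0, x r)) (fun r (z : P) => amul (y r) z.2).
  split=> [r|].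
    exists (fun=> 0), (amul (y r)); split; [exact: fspace0|by exists (y r)|].
    by apply/funext => z; rewrite add0r.
  apply/funext => z; rewrite op_corner aE amul_suml.
  rewrite (is_lin_sum (@inr_lin _ _ _ E)); apply: eq_bigr => r _.
  by rewrite /theta /= /dsum_rmul /= rmul0l amulA.
have V_hom : fmod_hom V Vs by case: hV.
have V0 : V 0 = 0 := rmod_hom0 (fmh_hom V_hom).
have Vs0 z r : Vs (fun=> amul (y r) 0) z = 0.
  have := congr1 (@^~ z) (fmh_starD V_hom (fspace0 E) (fspace0 E)).
  rewrite amul0r /= (_ : (fun=> 0 + 0) = (fun=> 0)); last first.
    by apply/funext => ?; rewrite addr0.
  by move=> VsD; apply: (addrI (Vs (fun=> 0) z)); rewrite -VsD addr0.
case: p => i l; rewrite coef_elt coef_basis xpair_eqE (is_linZ (ghomL e)).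
apply: op_inj => z; rewrite !coefD.
rewrite /op !lsub_valD lsub_valZ !addrfctE scalrfctE.
rewrite -![lsub_val _ z]/(op _ z) !(blockP _ _ eaE) -!big_split /=.
have mul0l b : dsum_rmul (0 : P) b = 0 := rmul0l P b.
have mul0r (w : P) : dsum_rmul w 0 = 0 := rmul0r w.
case: i l => [i|] [l|] /=; rewrite ?scale0r ?scale1r ?V0 ?coef0.
- by rewrite big1// => r _; rewrite Vs0 !mul0r !addr0.
- by rewrite big1// => r _; rewrite (_ : (0, 0) = 0 :> P)// !mul0l !addr0.
- by rewrite big1// => r _; rewrite Vs0 !mul0r !addr0.
rewrite -[corner_op a z]/(op (e a) z) eaE.2; apply: eq_bigr => r _.
by rewrite !mul0l !mul0r !addr0.
Qed.

(** Without [Source], vectors are placed in the [B]-parts of the coordinates and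
    functionals see these parts only, so that an entry is a sum of operators
    [theta_((0, u), (0, v))], i.e. of values of [e] at products [u v]. *)
Lemma rotation_path1_image k p : exists b,
  e b = coef (path_eval (ui1 R) (rotation_path hV delta_row k)) p.
Proof.
rewrite (@rotation_path_at Target); last by right.
have imD (X Y : compact_galg P) :
    (exists b, e b = X) -> (exists b, e b = Y) -> exists b, e b = X + Y.
  by move=> [b <-] [c <-]; exists (b + c); exact: is_linD (ghomL e) _ _.
have im (a b : summand) : a != Source -> b != Source ->
    exists c, e c = coef (blk a b k) p.
  move=> aS bS; have [J [eta [phi kE]]] := presents_exists k.
  case: p => i l.
  have /choice[u uE] (r : J) : exists u, placement V a i (eta r) = (0, u).
    case: a i aS => [] [i|] // _ /=; try by exists 0.
      by exists (eta r).2.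
    by exists (coef (V (eta r).1) i).
  have /choice[v vE] (r : J) :
      exists v, forall y, coplacement Vs b l (phi r) y = amul v y.2.
    have [c [phi1 phi2 _]] := fspace_dsumP (kE.1 r).
    case: b l bS => [] [l|] // _ /=;
      try by exists 0 => y; rewrite amul0l.
      by exists c.
    by have [x xE] := star_coef hV phi1; exists (coef x l).
  exists (\sum_r amul (u r) (v r)); apply: op_inj => y.
  rewrite (blockP _ _ kE) op_corner amul_suml.
  rewrite (is_lin_sum (@inr_lin _ _ _ E)); apply: eq_bigr => r _.
  by rewrite uE vE /= /dsum_rmul /= rmul0l amulA.
by rewrite !coefD; apply: (imD); apply: (imD); exact: im.
Qed.

End endpoints.

(** * Invertibility of the corner embedding *)

(** The inverse of [e] is [c^-1 f]: since [kappa] is cancellable,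
    [kappa e c^-1 f = Me c c^-1 f = Me f = kappa] gives [e c^-1 f = 1]. *)
Lemma invertible_of_factorization (R : realType) (G : groupType)
    (L : algebra_category R G) (B K MB MK : {A | ob L A})
    (e : hom B K) (c : hom B MB) (kappa : hom K MK) (Me : hom MB MK)
    (f : hom K MB) :
  invertible c -> invertible kappa ->
  comp f e = c -> comp Me c = comp kappa e -> comp Me f = kappa ->
  invertible e.
Proof.
move=> [c' [c'c cc']] [kappa' [kappa'K _]] fe Mec Mef.
exists (comp c' f); split; first by rewrite -compA fe.
rewrite -[LHS]comp_idl -kappa'K -!compA (compA kappa) -Mec -(compA Me).
by rewrite (compA c) cc' comp_idl Mef.
Qed.

Theorem proposition2p11 (R : realType) (G : groupType)
    (L : lambda_category R G) (B : galgebra R G) (obB : ob L B)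
    (faithB : left_faithful B)
    (I : choiceType) (adI : admissible L I)
    (delta : free_action R G I) (inv : coord_invariant B delta)
    (E : fmodule B)
    (V : E -> coord_fmodule inv) (Vs : (E -> B) -> coord_fmodule inv -> B)
    (hV : functional_extension V Vs)
    (hK : quadratik (compact_galg (dsum E (self_fmodule B)))) :
  invertible (mor (A := object obB) (B := object (ob_compact obB hK))
    (corner E (ob_quadratik obB))).
Proof.
have [B0|/existsNP[b /eqP b0]] := pselect (forall b : B, b = 0).
  apply: invertible_zero => // k.
  suff: forall k : compact_galg (dsum E (self_fmodule B)), k = 0 by apply.
  move=> {}k; apply: op_inj => x; rewrite op0.
  have [J [eta [phi [_ ->]]]] := presents_exists k.
  by rewrite big1// => r _; rewrite /theta [phi r x]B0 rmul0r.
have delta_row := coord_invariant_row_finite faithB b0 inv.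
set Bq := ob_quadratik obB; set e := corner E Bq.
set P := dsum E (self_fmodule B).
pose gamma := conj_action (option_action (free_matrix_action delta_row)).
pose Phi := rotation_path hV delta_row.
have adO := admissible_option adI.
pose obK : ob L (compact_galg P) := ob_compact obB hK.
have e_inj : injective e := @corner_inj R G B E Bq faithB.
have Me_inj : injective (mat_hom gamma e) := mat_hom_inj e_inj.
pose Phi0 := ghom_comp (ghom_eval _ (ui0 R)) Phi.
pose Phi1 := ghom_comp (ghom_eval _ (ui1 R)) Phi.
have [f fE] : exists f, ghom_comp (mat_hom gamma e) f = Phi1.
  apply: (ghom_factor Me_inj) => k; apply: (mat_hom_image e_inj) => p.
  exact: rotation_path1_image.
pose c := ghom_comp f e.
have MfE k : mat_hom gamma e (f k) = Phi1 k by rewrite -fE.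
have cE a : c a = elt (basis R[i] (None, None)) a.
  apply: Me_inj; rewrite MfE; apply: fam_inj => p.
  by rewrite rotation_path1_corner; exact/esym/coef_mat_map.
have c_inv := lam_corner (j := None) (gamma := gamma) obB adO cE.
have Phi0_inv := lam_corner (j := None) (gamma := gamma) (e := Phi0) obK adO
  (rotation_path0 hV delta_row).
apply: (invertible_of_factorization
  (Me := mor (A := object (ob_mat gamma obB adO))
     (B := object (ob_mat gamma obK adO)) (mat_hom gamma e))
  (f := mor (A := object obK) (B := object (ob_mat gamma obB adO)) f)
  c_inv Phi0_inv).
- by rewrite -mor_comp.
- rewrite -!mor_comp; congr mor; apply: ghom_eq => a.
  transitivity (mat_hom gamma e (elt (basis R[i] (None, None)) a)).
    by rewrite -cE.
  apply: (etrans _ (esym (rotation_path0 hV delta_row (e a)))).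
  apply: fam_inj => p; by rewrite coef_mat_map !coef_elt (is_linZ (ghomL e)).
- rewrite -mor_comp fE; apply/esym; exact: lam_homotopy.
Qed.
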